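(* Let $C_4$ be the cyclic group of order $4$ and $C_2\le C_4$ its subgroup of order $2$. Then the comparison homomorphism $\varphi_i\colon H_i(C_4,C_2;\mathbb{Z})\to H_i([C_4:C_2];\mathbb{Z})$ (with constant coefficients $\underline{\mathbb{Z}}$) vanishes for all $i\ge 2$; in particular, it is not an isomorphism.
   Context: Let $G$ be a discrete group, $H\le G$. With constant coefficients, i.e. coefficients in the constant functor $\underline{\mathbb{Z}}$ on the orbit category, the Bredon homology of a $G$-CW-complex (or pair) $X$ is the cellular homology $H_*(X/G;\mathbb{Z})$ of its orbit space. $EG$ is a contractible free $G$-CW-complex, $\mathrm{ind}_H^G EH=G\times_H EH$, and the $G$-map $\mathrm{ind}_H^G EH\to EG$ (unique up to $G$-homotopy) is assumed to be an inclusion by replacing $EG$ with a mapping cylinder. $\mathcal{F}(H)=\{K\le G : g^{-1}Kg\le H\text{ for some }g\in G\}$, and $E_{\mathcal{F}(H)}G$ is a $G$-CW-complex with isotropy groups in $\mathcal{F}(H)$ and contractible $K$-fixed points for all $K\in\mathcal{F}(H)$. Takasu relative homology: $H_*(G,H;\mathbb{Z})=H_*^G(EG,\mathrm{ind}_H^GEH;\underline{\mathbb{Z}})\ (=H_*(BG,BH;\mathbb{Z}))$. Adamson relative homology: $H_*([G:H];\mathbb{Z})=H^G_*(E_{\mathcal{F}(H)}G;\underline{\mathbb{Z}})=H_*(E_{\mathcal{F}(H)}G/G;\mathbb{Z})$. The Takasu space $T(G,H)$ is the $G$-pushout of $G/H\leftarrow \mathrm{ind}_H^G EH\to EG$, the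 left map collapsing each connected component to a point. Its isotropy lies in $\mathcal{F}(H)$, so there is a $G$-map $T(G,H)\to E_{\mathcal{F}(H)}G$, unique up to $G$-homotopy. For $n\ge2$, the comparison homomorphism $\varphi_n$ is the composite of the isomorphisms $H_n(G,H;\mathbb{Z})\cong H_n^G(T(G,H),G/H;\underline{\mathbb{Z}})\cong H_n^G(T(G,H);\underline{\mathbb{Z}})$ (induced by the maps of pairs) with the map $H_n^G(T(G,H);\underline{\mathbb{Z}})\to H_n^G(E_{\mathcal{F}(H)}G;\underline{\mathbb{Z}})$.
   Formalization: ''Not an isomorphism'' is stated and proved for odd i ≥ 3 only: for even i ≥ 2 both H_i(C_4,C_2;Z) and H_i([C_4:C_2];Z) are 0, so φ_i is trivially an isomorphism there. Homology of orbit spaces is taken as singular homology. *)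

(* Defs.v *)
From HB Require Import structures.
From Stdlib Require Import Relation_Operators.
From mathcomp Require Import all_boot all_order all_algebra all_fingroup.
From mathcomp Require Import all_solvable generic_quotient ring_quotient.
From mathcomp Require Import all_classical all_reals topology normedtype.
From mathcomp Require Import freeg.

Set Implicit Arguments.
Unset Strict Implicit.
Unset Printing Implicit Defensive.

Import Order.TTheory GRing.Theory Num.Theory.
Import numFieldNormedType.Exports.

Local Open Scope classical_set_scope.
Local Open Scope ring_scope.
Local Open Scope quotient_scope.

Section StandardSimplex.
Variable R : realType.

Definition std_simplex (n : nat) : set 'rV[R]_n.+1 :=
  [set t | (forall i, 0 <= t 0 i) /\ \sum_i t 0 i = 1].
Arguments std_simplex : clear implicits.

(* The i-th face map inserts a zero barycentric coordinate at position i. *)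
Definition face_fun n (i : 'I_n.+2) (t : 'rV[R]_n.+1) : 'rV[R]_n.+2 :=
  \row_j oapp (fun k => t 0 k) 0 (unlift i j).

Lemma face_fun_simplex n (i : 'I_n.+2) t :
  t \in std_simplex n -> face_fun i t \in std_simplex n.+1.
Proof.
move=> /set_mem[t0 t1]; apply/mem_set; split=> [j|].
  by rewrite mxE; case: (unlift i j).
rewrite (bigD1_ord i)//= mxE unlift_none add0r -[RHS]t1.
by apply: eq_bigr => k _; rewrite mxE liftK.
Qed.

Definition face n (i : 'I_n.+2) (t : std_simplex n) : std_simplex n.+1 :=
  exist _ (face_fun i (val t)) (face_fun_simplex i (valP t)).

Lemma face_continuous n i : continuous (@face n i).
Proof.
apply: continuous_comp_initial.
suff cf : continuous (@face_fun n i).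
  by move=> t; apply: (continuous_comp _ (cf _)); exact: initial_continuous.
move=> t A [P nP sPA].
exists (fun r k => P r (fintype.lift i k)) => [r k|u Pu].
  by have := nP r (fintype.lift i k); rewrite !mxE liftK (ord1 r).
apply: sPA => r j; rewrite (ord1 r) mxE; case: unliftP => [k ->|->] /=.
  exact: Pu.
have := nP 0 i; rewrite mxE unlift_none /=; exact: nbhs_singleton.
Qed.

HB.instance Definition _ n i := isContinuous.Build _ _ _ (@face_continuous n i).

End StandardSimplex.
Arguments std_simplex : clear implicits.

Record top_pair := TopPair {
  pair_space :> topologicalType;
  pair_sub : set pair_space }.
Arguments pair_sub : clear implicits.

Record pair_map (X Y : top_pair) := PairMap {
  pair_fun :> continuousType X Y;
  pair_funP : pair_fun @` pair_sub X `<=` pair_sub Y }.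

Section Chains.
Variables (R : realType) (X : topologicalType).

Definition singular (n : nat) := continuousType (std_simplex R n) X.
HB.instance Definition _ n := Choice.on (singular n).

Definition chain (n : nat) : lmodType int := {freeg (singular n) / int}.

Definition gen n (s : singular n) : chain n := << s >>.

Definition lift_chain (V : lmodType int) n (f : singular n -> V) : chain n -> V :=
  fglift f.

Lemma lift_chain_is_zmod_morphism V n f : zmod_morphism (@lift_chain V n f).
Proof. exact: lift_is_additive. Qed.
HB.instance Definition _ V n f := GRing.isZmodMorphism.Build _ _
  (@lift_chain V n f) (@lift_chain_is_zmod_morphism V n f).

Lemma lift_chain_gen V n f s : @lift_chain V n f (gen s) = f s.
Proof. by rewrite /lift_chain /gen liftU scale1r. Qed.

Lemma chain_sumE n (c : chain n) : c = \sum_(s <- dom c) gen s *~ coeff s c.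
Proof.
rewrite -[LHS](freeg_sumE (c : {freeg (singular n) / int})).
by apply: eq_bigr => s _; rewrite -[in LHS](intz (coeff s c)) -freegU_mulz.
Qed.

Lemma eq_additive_chain (V : zmodType) n (f g : {additive chain n -> V}) :
  f \o @gen n =1 g \o @gen n -> f =1 g.
Proof.
move=> fg c; rewrite (chain_sumE c) !raddf_sum; apply: eq_bigr => s _.
by rewrite [LHS](raddfMz f) [RHS](raddfMz g); congr (_ *~ _); exact: fg.
Qed.

Definition sface n (i : 'I_n.+2) (s : singular n.+1) : singular n :=
  s \o @face R n i.

Definition boundary n : chain n -> chain n.-1 :=
  if n is n'.+1 return chain n -> chain n.-1 then
    lift_chain (fun s : singular n'.+1 =>
      \sum_(i < n'.+2) (-1) ^+ i *: gen (sface i s))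
  else fun=> 0.
Arguments boundary : simpl never.

Lemma boundary_is_zmod_morphism n : zmod_morphism (@boundary n).
Proof.
case: n => [|n] x y; first by rewrite /boundary subr0.
exact: lift_chain_is_zmod_morphism.
Qed.
HB.instance Definition _ n :=
  GRing.isZmodMorphism.Build _ _ (@boundary n) (@boundary_is_zmod_morphism n).

Definition subchain (A : set X) {n} : {pred chain n} := fun c =>
  `[< forall s, s \in dom c -> range s `<=` A >].

Lemma subchain_zmod_closed A n : zmod_closed (@subchain A n).
Proof.
split=> [|c d /asboolP cA /asboolP dA]; first by apply/asboolP => s; rewrite dom0.
by apply/asboolP => s /domB; rewrite mem_cat => /orP[/cA|/dA].
Qed.
HB.instance Definition _ A n :=
  GRing.isZmodClosed.Build _ (@subchain A n) (@subchain_zmod_closed A n).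

End Chains.
Arguments singular : clear implicits.
Arguments chain : clear implicits.

Section Homology.
Variables (R : realType) (X : top_pair) (n : nat).

Definition rel_cycle : {pred chain R X n} :=
  fun c => boundary c \in subchain (pair_sub X).

Lemma rel_cycle_zmod_closed : zmod_closed rel_cycle.
Proof.
split=> [|c d cX dX]; rewrite unfold_in.
  by rewrite raddf0 rpred0.
by rewrite raddfB; apply: rpredB.
Qed.
HB.instance Definition _ :=
  GRing.isZmodClosed.Build _ rel_cycle rel_cycle_zmod_closed.

Record cycles := Cycle { cycle_chain :> chain R X n; _ : cycle_chain \in rel_cycle }.
HB.instance Definition _ := [isSub for cycle_chain].
HB.instance Definition _ := [Choice of cycles by <:].
HB.instance Definition _ := [SubChoice_isSubZmodule of cycles by <:].

Definition rel_boundary : {pred cycles} := fun z =>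
  `[< exists d : chain R X n.+1,
      (z : chain R X n) - boundary d \in subchain (pair_sub X) >].

Lemma rel_boundary_zmod_closed : zmod_closed rel_boundary.
Proof.
split=> [|y z /asboolP[d yd] /asboolP[e ze]]; apply/asboolP.
  by exists 0; rewrite raddf0 subr0 rpred0.
by exists (d - e); rewrite !raddfB addrACA -opprD rpredB.
Qed.
HB.instance Definition _ :=
  GRing.isZmodClosed.Build _ rel_boundary rel_boundary_zmod_closed.

(* Absolute homology is the case pair_sub X = set0. *)
Definition homology : zmodType := Quotient.quot rel_boundary.

End Homology.

Section HomologyMap.
Variables (R : realType) (X Y : top_pair) (f : pair_map X Y).

Definition push n : chain R X n -> chain R Y n :=
  lift_chain (fun s : singular R X n => gen (f \o s : singular R Y n)).

Lemma push_is_zmod_morphism n : zmod_morphism (@push n).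
Proof. exact: lift_chain_is_zmod_morphism. Qed.
HB.instance Definition _ n :=
  GRing.isZmodMorphism.Build _ _ (@push n) (@push_is_zmod_morphism n).

Lemma boundary_push n (c : chain R X n) : boundary (push c) = push (boundary c).
Proof.
case: n c => [|n] c; first by rewrite raddf0.
apply: (@eq_additive_chain _ _ _ _ (@boundary R Y n.+1 \o @push n.+1)
  (@push n \o @boundary R X n.+1)) => s /=.
rewrite /push /boundary [in LHS]/= !lift_chain_gen raddf_sum; apply: eq_bigr => i _.
rewrite raddfZsign /= lift_chain_gen; congr (_ *: gen _).
exact/continuousEP.
Qed.

Lemma push_subchain n (c : chain R X n) :
  c \in subchain (pair_sub X) -> push c \in subchain (pair_sub Y).
Proof.
move=> /asboolP cX; rewrite (chain_sumE c) raddf_sum big_seq.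
apply: rpred_sum => s /cX sX; rewrite raddfMz rpredMz//= /push lift_chain_gen.
apply/asboolP => t; rewrite domU1 inE => /eqP -> y [u _ <-].
by apply: (pair_funP (p := f)); exists (s u) => //; apply: sX; exists u.
Qed.

Lemma push_cycle n (z : cycles R X n) : push z \in @rel_cycle R Y n.
Proof.
rewrite unfold_in boundary_push; apply: push_subchain.
exact: (valP z).
Qed.

Definition cycle_map n (z : cycles R X n) : cycles R Y n := Cycle (push_cycle z).

Definition homology_map n (x : homology R X n) : homology R Y n :=
  \pi_(homology R Y n) (cycle_map (repr x)).

Lemma homology_map_pi n (z : cycles R X n) :
  homology_map (\pi_(homology R X n) z) =
  \pi_(homology R Y n) (cycle_map z).
Proof.
apply/eqP; rewrite -Quotient.idealrBE; apply/asboolP.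
have /asboolP[d dX] : repr (\pi_(homology R X n) z) - z \in @rel_boundary R X n.
  by rewrite Quotient.idealrBE reprK.
exists (push d); rewrite boundary_push.
by have := push_subchain dX; rewrite 2!raddfB.
Qed.

Lemma homology_map_is_zmod_morphism n : zmod_morphism (@homology_map n).
Proof.
move=> x y; rewrite -[x]reprK -[y]reprK -raddfB !homology_map_pi -raddfB.
by congr (\pi_(homology R Y n) _); apply: val_inj; rewrite /= !raddfB.
Qed.
HB.instance Definition _ n := GRing.isZmodMorphism.Build _ _
  (@homology_map n) (@homology_map_is_zmod_morphism n).

End HomologyMap.

Section QuotientSpace.
Variables (X : topologicalType) (r : X -> X -> Prop).

Definition gen_equiv : rel X := fun x y => `[< clos_refl_sym_trans X r x y >].

Lemma gen_equivP : equiv_class_of gen_equiv.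
Proof.
split=> [x|x y|y x z]; first exact/asboolP/rst_refl.
  by apply/asboolP/asboolP => xy; exact: rst_sym.
by move=> /asboolP xy /asboolP yz; apply/asboolP; exact: rst_trans xy yz.
Qed.

Canonical gen_equiv_rel := EquivRelPack gen_equivP.
Canonical gen_equiv_encModRel := defaultEncModRel gen_equiv.

Definition quot_space : topologicalType := quotient_topology {eq_quot gen_equiv}.

Definition quot_proj : X -> quot_space := \pi_({eq_quot gen_equiv}).

Definition quot_lift Z (f : X -> Z) : quot_space -> Z :=
  fun q => f (repr (q : {eq_quot gen_equiv})).

Lemma quot_proj_eq x y : r x y -> quot_proj x = quot_proj y.
Proof. by move=> xy; apply/eqmodP/asboolP; exact: rst_step. Qed.

Lemma quot_lift_proj Z (f : X -> Z) x : (forall x y, r x y -> f x = f y) ->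
  quot_lift f (quot_proj x) = f x.
Proof.
move=> fr; have fc y z : clos_refl_sym_trans X r y z -> f y = f z.
  by elim=> [u v /fr|u|u v _ ->|u v w _ -> _ ->].
apply: fc; apply/asboolP.
have /eqmodP : repr (\pi_({eq_quot gen_equiv}) x) = x %[mod {eq_quot gen_equiv}].
  by rewrite reprK.
exact.
Qed.

Lemma quot_proj_continuous : continuous quot_proj.
Proof. exact: pi_continuous. Qed.

Lemma quot_proj_surj q : exists x, q = quot_proj x.
Proof. by exists (repr (q : {eq_quot gen_equiv})); rewrite /quot_proj reprK. Qed.

Lemma quot_lift_continuous (Z : topologicalType) (f : X -> Z) :
  (forall x y, r x y -> f x = f y) -> continuous f -> continuous (quot_lift f).
Proof.
move=> fr cf; apply/quotient_continuous.
by rewrite (_ : _ \o _ = f)//; apply/funext => x; exact: quot_lift_proj.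
Qed.

End QuotientSpace.

Section GSpaces.
Variables (gT : finGroupType) (G : {group gT}).
Local Open Scope group_scope.

(* The elements of gT outside G act by arbitrary maps. *)
Record gspace := GSpace {
  gcarrier :> topologicalType;
  gact : gT -> gcarrier -> gcarrier;
  gact1 : gact 1 =1 id;
  gactM : {in G &, forall g h x, gact (g * h) x = gact g (gact h x)};
  gact_continuous : {in G, forall g, continuous (gact g)} }.

Record gmap (X Y : gspace) := GMap {
  gfun :> continuousType X Y;
  gfunJ : {in G, forall g x, gfun (gact g x) = gact g (gfun x)} }.

Definition orbit_rel (X : gspace) (x y : X) : Prop :=
  exists2 g, g \in G & y = gact g x.

Definition orbit_space (X : gspace) : topologicalType := quot_space (@orbit_rel X).

Definition orbit_pair (X : gspace) (A : set X) : top_pair :=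
  TopPair (quot_proj (@orbit_rel X) @` A).

Section OrbitMap.
Variables (X Y : gspace) (f : gmap X Y).

Lemma orbit_fun_subproof x y : orbit_rel x y ->
  (quot_proj (@orbit_rel Y) \o f) x = (quot_proj (@orbit_rel Y) \o f) y.
Proof.
by move=> [g Gg ->]; apply: quot_proj_eq; exists g => //; rewrite gfunJ.
Qed.

Definition orbit_fun : orbit_space X -> orbit_space Y :=
  quot_lift (quot_proj (@orbit_rel Y) \o f).

Lemma orbit_fun_continuous : continuous orbit_fun.
Proof.
apply: quot_lift_continuous; first exact: orbit_fun_subproof.
by move=> x; apply: continuous_comp; [exact: cts_fun|exact: quot_proj_continuous].
Qed.
HB.instance Definition _ := isContinuous.Build _ _ orbit_fun orbit_fun_continuous.

Variables (A : set X) (B : set Y).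
Hypothesis fAB : f @` A `<=` B.

Lemma orbit_fun_sub :
  orbit_fun @` pair_sub (orbit_pair A) `<=` pair_sub (orbit_pair B).
Proof.
move=> _ [_ [x Ax <-] <-]; rewrite /orbit_fun quot_lift_proj.
  by exists (f x) => //; apply: fAB; exists x.
exact: orbit_fun_subproof.
Qed.

Definition orbit_map : pair_map (orbit_pair A) (orbit_pair B) :=
  @PairMap (orbit_pair A) (orbit_pair B) orbit_fun orbit_fun_sub.

End OrbitMap.

Section QuotientGSpace.
Variables (X : gspace) (r : X -> X -> Prop).
Hypothesis rG : {in G, forall g x y, r x y -> r (gact g x) (gact g y)}.

Definition quot_act (g : gT) : quot_space r -> quot_space r :=
  quot_lift (quot_proj r \o gact g).

Let quot_act_proj : {in G, forall g x,
  quot_act g (quot_proj r x) = quot_proj r (gact g x)}.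
Proof.
move=> g Gg x; apply: quot_lift_proj => y z yz.
by apply: quot_proj_eq; exact: rG.
Qed.

Lemma quot_act1 : quot_act 1 =1 id.
Proof.
by move=> q; have [x ->] := quot_proj_surj q; rewrite quot_act_proj// gact1.
Qed.

Lemma quot_actM :
  {in G &, forall g h q, quot_act (g * h) q = quot_act g (quot_act h q)}.
Proof.
move=> g h Gg Gh q; have [x ->] := quot_proj_surj q.
by rewrite !quot_act_proj ?groupM// gactM.
Qed.

Lemma quot_act_continuous : {in G, forall g, continuous (quot_act g)}.
Proof.
move=> g Gg; apply: quot_lift_continuous => [x y xy|x].
  by apply: quot_proj_eq; exact: rG.
apply: continuous_comp; first exact: gact_continuous.
exact: quot_proj_continuous.
Qed.

Definition quot_gspace : gspace := GSpace quot_act1 quot_actM quot_act_continuous.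

Lemma quot_gprojJ : {in G, forall g x,
  (quot_proj r (gact g x) : quot_gspace) = gact g (quot_proj r x : quot_gspace)}.
Proof. by move=> g Gg x; rewrite [RHS]quot_act_proj. Qed.

End QuotientGSpace.

End GSpaces.

Section DisjointUnion.
Variables B C : topologicalType.

Definition disjoint_union : Type := (B + C)%type.
HB.instance Definition _ := Choice.on disjoint_union.

Definition union_open : set_system disjoint_union :=
  [set A | open ((inl : B -> B + C) @^-1` A) /\ open ((inr : C -> B + C) @^-1` A)].

Let union_openT : union_open setT.
Proof. by split; exact: openT. Qed.

Let union_openI : setI_closed union_open.
Proof. by move=> A A' [? ?] [? ?]; split; exact: openI. Qed.

Let union_open_bigU (I : Type) (A : I -> set disjoint_union) :
  (forall i, union_open (A i)) -> union_open (\bigcup_i A i).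
Proof.
by move=> oA; split; rewrite preimage_bigcup; apply: bigcup_open => i _;
  have [] := oA i.
Qed.

HB.instance Definition _ :=
  isOpenTopological.Build disjoint_union union_openT union_openI union_open_bigU.

End DisjointUnion.

Section Pushout.
Variables (gT : finGroupType) (G : {group gT}) (A B C : gspace G).
Variables (p : gmap A B) (q : gmap A C).

Definition union_act (g : gT) (u : disjoint_union B C) : disjoint_union B C :=
  match u with inl b => inl (gact g b) | inr c => inr (gact g c) end.

Lemma union_act1 : union_act 1%g =1 id.
Proof. by case=> x /=; rewrite gact1. Qed.

Lemma union_actM :
  {in G &, forall g h u, union_act (g * h)%g u = union_act g (union_act h u)}.
Proof. by move=> g h Gg Gh [] x /=; rewrite gactM. Qed.

Lemma union_act_continuous : {in G, forall g, continuous (union_act g)}.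
Proof.
move=> g Gg; apply/continuousP => U [oB oC].
have /continuousP cB : continuous (gact g : B -> B) by exact: gact_continuous.
have /continuousP cC : continuous (gact g : C -> C) by exact: gact_continuous.
by split; [exact: (cB _ oB)|exact: (cC _ oC)].
Qed.

Definition union_gspace : gspace G :=
  GSpace union_act1 union_actM union_act_continuous.

Definition pushout_rel (u v : union_gspace) : Prop :=
  exists a : A, u = inl (p a) /\ v = inr (q a).

Lemma pushout_relJ : {in G, forall g u v,
  pushout_rel u v -> pushout_rel (gact g u) (gact g v)}.
Proof.
by move=> g Gg _ _ [a [-> ->]]; exists (gact g a); rewrite !gfunJ.
Qed.

Definition pushout : gspace G := quot_gspace pushout_relJ.

Definition pushout_inl_fun (b : B) : pushout :=
  quot_proj pushout_rel (inl b : union_gspace).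
Definition pushout_inr_fun (c : C) : pushout :=
  quot_proj pushout_rel (inr c : union_gspace).

Lemma pushout_inl_continuous : continuous pushout_inl_fun.
Proof.
suff ci : continuous (inl : B -> union_gspace).
  move=> b; apply: (@continuous_comp _ _ _ _ (quot_proj pushout_rel)).
    exact: ci.
  exact: quot_proj_continuous.
by apply/continuousP => U [].
Qed.
HB.instance Definition _ := isContinuous.Build _ _ _ pushout_inl_continuous.

Lemma pushout_inr_continuous : continuous pushout_inr_fun.
Proof.
suff ci : continuous (inr : C -> union_gspace).
  move=> b; apply: (@continuous_comp _ _ _ _ (quot_proj pushout_rel)).
    exact: ci.
  exact: quot_proj_continuous.
by apply/continuousP => U [].
Qed.
HB.instance Definition _ := isContinuous.Build _ _ _ pushout_inr_continuous.

Lemma pushout_inlJ : {in G, forall g b,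
  pushout_inl_fun (gact g b) = gact g (pushout_inl_fun b)}.
Proof. by move=> g Gg b; rewrite /pushout_inl_fun -(quot_gprojJ pushout_relJ). Qed.

Lemma pushout_inrJ : {in G, forall g c,
  pushout_inr_fun (gact g c) = gact g (pushout_inr_fun c)}.
Proof. by move=> g Gg b; rewrite /pushout_inr_fun -(quot_gprojJ pushout_relJ). Qed.

Definition pushout_inl : gmap B pushout :=
  @GMap _ _ B pushout pushout_inl_fun pushout_inlJ.
Definition pushout_inr : gmap C pushout :=
  @GMap _ _ C pushout pushout_inr_fun pushout_inrJ.

End Pushout.

Section Induction.
Variables (gT : finGroupType) (H : {group gT}).
Local Notation G := [set: gT]%G.
Local Open Scope group_scope.

Definition translation_space : topologicalType := discrete_topology gT.

Definition translation (g : gT) (a : translation_space) : translation_space :=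
  (g * (a : gT) : gT).

Lemma translation1 : translation 1 =1 id.
Proof. exact: mul1g. Qed.

Lemma translationM : {in G &, forall g h a,
  translation (g * h) a = translation g (translation h a)}.
Proof. by move=> g h _ _ a; rewrite /translation mulgA. Qed.

Lemma translation_continuous : {in G, forall g, continuous (translation g)}.
Proof.
move=> g _; apply/continuousP => U _.
exact: (@discrete_open (discrete_topology gT)).
Qed.

Definition translation_gspace : gspace G :=
  GSpace translation1 translationM translation_continuous.

Definition coset_rel (a b : translation_gspace) : Prop :=
  exists2 h, h \in H & b = (a : gT) * h :> gT.

Lemma coset_relJ : {in G, forall g a b,
  coset_rel a b -> coset_rel (gact g a) (gact g b)}.
Proof. by move=> g _ a _ [h Hh ->]; exists h => //; rewrite /= /translation mulgA. Qed.

Definition coset_gspace : gspace G := quot_gspace coset_relJ.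

Variable X : gspace H.

Definition product_act (g : gT) (p : translation_space * X) :
  translation_space * X := (translation g p.1, p.2).

Lemma product_act1 : product_act 1 =1 id.
Proof. by case=> a x; rewrite /product_act translation1. Qed.

Lemma product_actM : {in G &, forall g h p,
  product_act (g * h) p = product_act g (product_act h p)}.
Proof. by move=> g h Gg Gh [a x]; rewrite /product_act translationM. Qed.

Lemma product_act_continuous : {in G, forall g, continuous (product_act g)}.
Proof.
move=> g Gg p; apply: (@cvg_pair _ _ _ _ (nbhs _) (nbhs _)); last exact: cvg_snd.
apply: (@continuous_comp _ _ _ fst (translation g)); first exact: cvg_fst.
exact: translation_continuous.
Qed.

Definition product_gspace : gspace G :=
  GSpace product_act1 product_actM product_act_continuous.

Definition induced_rel (p q : product_gspace) : Prop :=
  exists2 h, h \in H & exists g x, p = (g * h, x) /\ q = (g, gact h x).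

Lemma induced_relJ : {in G, forall g p q,
  induced_rel p q -> induced_rel (gact g p) (gact g q)}.
Proof.
move=> g _ _ _ [h Hh [k [x [-> ->]]]]; exists h => //.
by exists (g * k), x; rewrite /= /product_act/= /translation mulgA.
Qed.

(* ind_H^G X, the quotient of G x X by (g h, x) ~ (g, h x) for h in H *)
Definition induced : gspace G := quot_gspace induced_relJ.

(* The G-map [g, x] |-> gH: for connected X its fibres are the connected
   components of ind_H^G X. *)
Definition collapse_fun : induced -> coset_gspace :=
  quot_lift (fun p : product_gspace => quot_proj coset_rel p.1).

Let collapse_rel p q : induced_rel p q ->
  quot_proj coset_rel p.1 = quot_proj coset_rel q.1.
Proof.
move=> [h Hh [g [x [-> ->]]]] /=; apply/esym/quot_proj_eq.
by exists h.
Qed.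

Lemma collapse_continuous : continuous collapse_fun.
Proof.
apply: quot_lift_continuous; first exact: collapse_rel.
by move=> p; apply: continuous_comp; [exact: cvg_fst|exact: quot_proj_continuous].
Qed.
HB.instance Definition _ := isContinuous.Build _ _ collapse_fun collapse_continuous.

Lemma collapseJ : {in G, forall g p,
  collapse_fun (gact g p) = gact g (collapse_fun p)}.
Proof.
move=> g Gg p; have [x ->] := quot_proj_surj p.
rewrite -(quot_gprojJ induced_relJ)// /collapse_fun !quot_lift_proj//.
exact: (quot_gprojJ coset_relJ).
Qed.

Definition collapse : gmap induced coset_gspace :=
  @GMap _ _ induced coset_gspace collapse_fun collapseJ.

End Induction.

Section Discs.
Variables (R : realType) (n : nat).

Definition disc : set 'rV[R]_n := [set x | \sum_i x 0 i ^+ 2 <= 1].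
Definition open_disc : set 'rV[R]_n := [set x | \sum_i x 0 i ^+ 2 < 1].
Definition sphere : set 'rV[R]_n := [set x | \sum_i x 0 i ^+ 2 = 1].

End Discs.
Arguments disc : clear implicits.
Arguments open_disc : clear implicits.
Arguments sphere : clear implicits.

(* A G-CW-structure on X.  The skeleta are shifted by one, skel n being the
   (n-1)-skeleton, so that skel 0 is empty and skel n.+1 arises from skel n by
   attaching the equivariant n-cells G/K_e x D^n, e : cell n, K_e = cell_stab e.
   Since G is discrete, a G-map G/K x D^n -> X is the same thing as a map D^n ->
   X whose values are fixed by K, the former being (gK, x) |-> g q(x) for q the
   latter; char_map e is q for the characteristic map of e.
   Hausdorffness follows from the other conditions and is listed, as usual, for
   convenience.  The fields from char_continuous on say that
     \coprod_e G/K_e x S^(n-1) --> skel n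
               |                     |
     \coprod_e G/K_e x D^n ----> skel n.+1
   is a pushout of G-spaces: it is one of sets because the open cells are mapped
   bijectively to skel n.+1 minus skel n, and skel n.+1 has the final topology. *)
Record gcw (R : realType) (gT : finGroupType) (G : {group gT}) (X : gspace G) :=
GCW {
  skel : nat -> set X;
  cell : nat -> Type;
  cell_stab : forall {n}, cell n -> {group gT};
  char_map : forall {n}, cell n -> 'rV[R]_n -> X;

  gcw_hausdorff : hausdorff_space X;
  skel_closed : forall n, closed (skel n);
  skel_invariant : forall n, {in G, forall g, gact g @` skel n `<=` skel n};
  skel0 : skel 0%N = set0;
  skel_incr : forall n, skel n `<=` skel n.+1;
  skel_cover : \bigcup_n skel n = setT;
  skel_colimit : forall A : set X,
    (forall n, closed (A `&` skel n)) -> closed A;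

  cell_stab_sub : forall n (e : cell n), (cell_stab e \subset G)%g;
  char_continuous : forall n (e : cell n),
    {within disc R n, continuous (char_map e)};
  char_fixed : forall n (e : cell n), {in cell_stab e, forall k x, disc R n x ->
    gact k (char_map e x) = char_map e x};
  char_sphere : forall n (e : cell n), char_map e @` sphere R n `<=` skel n;
  char_open_disc : forall n (e : cell n),
    char_map e @` open_disc R n `<=` skel n.+1 `\` skel n;
  char_surj : forall n y, (skel n.+1 `\` skel n) y ->
    exists (e : cell n) g x,
      [/\ g \in G, open_disc R n x & y = gact g (char_map e x)];
  char_inj : forall n (e e' : cell n) g g' x x', g \in G -> g' \in G ->
    open_disc R n x -> open_disc R n x' ->
    gact g (char_map e x) = gact g' (char_map e' x') ->
    [/\ e = e', x = x' & (g^-1 * g')%g \in cell_stab e];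
  skel_attach : forall n (A : set X), A `<=` skel n.+1 ->
    closed (A `&` skel n) ->
    (forall e : cell n, {in G, forall g,
       closed [set x | disc R n x /\ A (gact g (char_map e x))]}) ->
    closed A }.

Definition subcomplex (R : realType) (gT : finGroupType) (G : {group gT})
    (X : gspace G) (cX : gcw R X) (A : set X) : Prop :=
  {in G, forall g, gact g @` A `<=` A} /\
  forall n (e : cell cX n) x, open_disc R n x -> A (char_map e x) ->
    char_map e @` disc R n `<=` A.

(* Subcomplexes are closed, so an isomorphism onto a subcomplex is the same as a
   closed embedding whose range is one. *)
Definition subcomplex_inclusion (R : realType) (gT : finGroupType)
    (G : {group gT}) (X Y : gspace G) (cY : gcw R Y) (i : gmap X Y) : Prop :=
  [/\ injective i, forall C, closed C -> closed (i @` C) &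
      subcomplex cY (range i)].

Definition contractible (R : realType) (X : topologicalType) (A : set X) : Prop :=
  exists2 x0, A x0 & exists h : X * R -> X,
    [/\ {within A `*` `[0, 1], continuous h},
        h @` (A `*` `[0, 1]) `<=` A,
        forall x, A x -> h (x, 0) = x &
        forall x, A x -> h (x, 1) = x0].

Section ClassifyingSpaces.
Variables (R : realType) (gT : finGroupType) (G : {group gT}).
Local Open Scope group_scope.

Definition isotropy (X : gspace G) (x : X) : {set gT} :=
  finset (fun g => (g \in G) && `[< gact g x = x >]).

Definition fixed_points (X : gspace G) (K : {set gT}) : set X :=
  [set x | {in K, forall k, gact k x = x}].
Arguments fixed_points : clear implicits.

Definition free_contractible (X : gspace G) : Prop :=
  (forall x : X, isotropy x = 1) /\ contractible R [set: X].

Definition classifying_space (F : set {group gT}) (X : gspace G) : Prop :=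
  (forall x : X, exists2 K : {group gT}, F K & isotropy x = K) /\
  (forall K : {group gT}, F K -> contractible R (fixed_points X K)).

(* The family F(H) of the subgroups of G subconjugate to H *)
Definition subconjugates (H : {group gT}) : set {group gT} :=
  [set K : {group gT} | K \subset G /\ exists2 g, g \in G & K :^ g \subset H].

End ClassifyingSpaces.

Section BredonHomology.
Variables (R : realType) (gT : finGroupType) (G : {group gT}).

(* For constant coefficients, the Bredon chain complex of a G-CW-pair (X, A) is
   the cellular chain complex of the CW-pair (X/G, A/G).  Its homology is taken
   here in the form of singular homology, which is naturally isomorphic to
   cellular homology on CW-pairs and needs no choice of a CW-structure on the
   Takasu space nor a cellular approximation of the maps involved. *)
Definition bredon (X : gspace G) (A : set X) (n : nat) : zmodType :=
  homology R (orbit_pair A) n.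

Definition bredon_map (X Y : gspace G) (f : gmap X Y) (A : set X) (B : set Y)
    (fAB : f @` A `<=` B) n : bredon A n -> bredon B n :=
  homology_map (orbit_map fAB) (n := n).

Definition gidfun (X : gspace G) : gmap X X :=
  @GMap _ _ X X idfun (fun g _ x => erefl).

End BredonHomology.

Section Comparison.
Variables (R : realType) (gT : finGroupType) (H : {group gT}).
Local Notation G := [set: gT]%G.
Variables (EH : gspace H) (EG : gspace G) (i : gmap (induced EH) EG).

Definition takasu_homology (n : nat) : zmodType := bredon R (range i) n.

Definition adamson_homology (EFG : gspace G) (n : nat) : zmodType :=
  bredon R (@set0 EFG) n.

Definition takasu_space : gspace G := pushout (collapse EH) i.

Definition takasu_base : set takasu_space := range (pushout_inl (collapse EH) i).

Lemma takasu_range :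
  pushout_inr (collapse EH) i @` range i `<=` takasu_base.
Proof.
move=> _ [_ [a _ <-] <-]; exists (collapse EH a) => //.
by apply: quot_proj_eq; exists a.
Qed.

Lemma takasu_set0 : gidfun takasu_space @` set0 `<=` takasu_base.
Proof. by rewrite image_set0. Qed.

Definition takasu_to_relative n : takasu_homology n -> bredon R takasu_base n :=
  bredon_map takasu_range (n := n).

Definition takasu_relativize n :
    bredon R (@set0 takasu_space) n -> bredon R takasu_base n :=
  bredon_map takasu_set0 (n := n).

Variables (EFG : gspace G) (f : gmap takasu_space EFG).

Lemma gmap_set0 : f @` set0 `<=` @set0 EFG.
Proof. by rewrite image_set0. Qed.

(* The map takasu_relativize from H_n of T(G, H) to H_n of (T(G, H), G/H) is
   bijective for n >= 2, as T(G, H)/G contains (G/H)/G as a single point; xget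
   picks its inverse.  Only the degrees n >= 2 are meaningful. *)
Definition comparison n (x : takasu_homology n) : adamson_homology EFG n :=
  bredon_map gmap_set0
    (xget 0 [set y | takasu_relativize y = takasu_to_relative x]).

End Comparison.

(* Main.v *)
(** Simplices lift through the free quotients, so the chains of [Y/G] are the
    coinvariants of the chains of [Y].  For [G] cyclic, generated by [t], and [Y]
    contractible, a cycle of coinvariants is determined up to boundaries by the
    integer at the end of a zigzag in the augmented complex of [Y] that alternates
    the boundary with [t - 1] and the norm [N].

    Along [C_2 <= C_4] this integer is doubled in odd degrees, so [H_n(BC_2)] injects
    into [H_n(BC_4)] and every relative cycle is, up to chains of [BC_2] (which the
    Takasu space collapses to a point), an absolute cycle of [BC_4].  In even degrees
    the zigzag integer vanishes.  In odd degrees [n >= 3] the zigzag can be pushed,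
    in [E_F(H) G], into the contractible set of [H]-fixed points, where [N] is
    [2 (1 + t)]; the image of the cycle is then a multiple of [2 v] with [v] a fixed
    chain such that [(1 + t) v] is a boundary, and [2 v = (1 + t) v - (t - 1) v]
    vanishes in the coinvariants.

    Conversely the class with zigzag integer 1 is nonzero in the relative homology
    of odd degree, since chains of [BC_2] change the integer by even numbers and
    boundaries change it by multiples of 4. *)
Require Import Defs.
From HB Require Import structures.
From Stdlib Require Import Relation_Operators.
From mathcomp Require Import all_boot all_order all_algebra all_fingroup zify lra.
From mathcomp Require Import all_solvable generic_quotient.
From mathcomp Require Import all_classical all_reals topology normedtype.
From mathcomp Require freeg.
(* mathcomp's [action] also exports a [gact]. *)
Import Defs.

Set Implicit Arguments.
Unset Strict Implicit.
Unset Printing Implicit Defensive.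

Import Order.TTheory GRing.Theory Num.Theory.
Import numFieldNormedType.Exports.

Local Open Scope classical_set_scope.
Local Open Scope ring_scope.
Local Open Scope quotient_scope.

Arguments boundary : simpl never.

(** * Zigzags in a complex with two alternating operators *)

Section Zigzag.
Variables (C : nat -> zmodType) (d : forall n, {additive C n.+1 -> C n}).
Variable T : bool -> forall n, {additive C n -> C n}.

(* [T true] plays the part of [t - 1], [T false] that of the norm; [C 0] is the
   augmentation group, so [C n.+1] holds the chains of degree [n]. *)
Fixpoint zigzag (b : bool) n : C n.+1 -> C 0 -> Prop :=
  if n is n'.+1 return C n.+1 -> C 0 -> Prop then
    fun z a => exists2 z', d n'.+1 z = T b n'.+1 z' & zigzag (~~ b) z' a
  else fun z a => d 0 z = a.

Lemma zigzagB b n (z z' : C n.+1) a a' :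
  zigzag b z a -> zigzag b z' a' -> zigzag b (z - z') (a - a').
Proof.
elim: n b z z' => [|n IHn] b z z' /=; first by move=> <- <-; rewrite raddfB.
move=> [y dz zy] [y' dz' zy']; exists (y - y'); last exact: IHn.
by rewrite !raddfB dz dz'.
Qed.

Hypothesis dd : forall n x, d n (d n.+1 x) = 0.
Hypothesis dT : forall b n x, d n (T b n.+1 x) = T b n (d n x).
Hypothesis TT : forall b n x, T b n (T (~~ b) n x) = 0.
Hypothesis d_exact : forall n x, d n x = 0 -> exists y, x = d n.+1 y.
Hypothesis d_surj : forall a, exists x, d 0 x = a.

(** Applying [d] to the last equation [d 1 z = T y] of the zigzag gives [T (d 0 y) = 0]; since the
    operators alternate, the one met there is [T (b (+) odd n)]. *)
Lemma zigzag_constraint b n (z : C n.+2) a :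
  zigzag b z a -> T (b (+) odd n) 0 a = 0.
Proof.
elim: n b z => [|n IHn] b z [y dz yz] /=.
  by rewrite addbF -yz -dT -dz dd.
by rewrite addbN -addNb; exact: IHn yz.
Qed.

(** Works up from the bottom: if the entry below [z] is [d w + T (~~ b) w'], then [z - T b w] is a
    cycle by [TT], hence a boundary. *)
Lemma zigzag_vanish b n (z : C n.+1) a a' :
  zigzag b z a -> a = T (b (+) odd n) 0 a' -> exists w w', z = d n.+1 w + T b n.+1 w'.
Proof.
move=> zz aE; elim: n b z zz aE => [|n IHn] b z /= zz aE.
  have [y dy] := d_surj a'; have [|w wE] := @d_exact 0 (z - T b 1 y).
    by rewrite raddfB dT zz dy aE addbF subrr.
  by exists w, y; rewrite -wE subrK.
move: zz => [y dz /IHn[|w [w' yE]]]; first by rewrite aE addbN addNb.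
have [|v vE] := @d_exact n.+1 (z - T b n.+2 w).
  by rewrite raddfB dT dz yE raddfD TT addr0 subrr.
by exists v, w; rewrite -vE subrK.
Qed.

(** Built from the augmentation upwards: [T b z] is a cycle, by [TT] or, at the bottom, by the
    condition on [a], so it is the boundary of the next entry. *)
Lemma zigzag_construct b n a : T (~~ (b (+) odd n)) 0 a = 0 ->
  exists z : C n.+1, zigzag b z a.
Proof.
elim: n b => [|n IHn] b /= Ta; first exact: d_surj.
have [|z zz] := IHn (~~ b); first by move: Ta; rewrite addbN addNb.
have [|w wE] := @d_exact n (T b n.+1 z); last by exists w, z.
rewrite dT; case: n z {IHn} Ta zz => [|n] z Ta /=.
  by move=> ->; move: Ta; rewrite /= addbT negbK.
by case=> y -> _; exact: TT.
Qed.

Hypothesis T_exact : forall b n (x : C n.+1),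
  T b n.+1 x = 0 -> exists y, x = T (~~ b) n.+1 y.

(** From [d z = T b y] follows [T b (d y) = 0], and exactness of the operators supplies the next
    entry. *)
Lemma zigzag_exists b n (z : C n.+2) y :
  d n.+1 z = T b n.+1 y -> exists a, zigzag b z a.
Proof.
elim: n b z y => [|n IHn] b z y dz; first by exists (d 0 y), y.
have [|y' yE] := @T_exact b n (d n.+1 y); first by rewrite -dT -dz dd.
by have [a aE] := IHn _ _ _ yE; exists a, y.
Qed.

(** Well-definedness of the end value modulo an image of [T]. The next entry [y] differs from [d w']
    by an image of [T (~~ b)], which is the same situation one degree lower. *)
Lemma zigzag_unique b n w w' a :
  zigzag b (d n.+1 w + T b n.+1 w') a -> exists a', a = T (b (+) odd n) 0 a'.
Proof.
elim: n b w w' => [|n IHn] b w w' /=.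
  by rewrite raddfD dd add0r dT addbF => <-; exists (d 0 w').
rewrite raddfD dd add0r dT => -[y dy].
have [|y' yE] := @T_exact b n (y - d n.+1 w'); first by rewrite raddfB -dy subrr.
by rewrite -[y](subrK (d n.+1 w')) yE addrC addbN -addNb; exact: IHn.
Qed.

End Zigzag.

(** * Restriction of zigzags along a subgroup of index two *)

Section Restriction.
Variables (C D : nat -> zmodType).
Variables (dC : forall n, {additive C n.+1 -> C n}) (dD : forall n, {additive D n.+1 -> D n}).
Variables (TC : bool -> forall n, {additive C n -> C n}).
Variables (TD : bool -> forall n, {additive D n -> D n}).
Variables (P : forall n, {additive C n -> C n}) (j : forall n, {additive D n -> C n}).
Hypothesis dj : forall n x, dC n (j n.+1 x) = j n (dD n x).
Hypothesis dP : forall n x, dC n (P n.+1 x) = P n (dC n x).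
Hypothesis jT1 : forall n x, j n (TD true n x) = TC true n (P n (j n x)).
Hypothesis jT0 : forall n x, P n (j n (TD false n x)) = TC false n (j n x).

(** Here [P] stands for [1 + t]. As [t^2 - 1 = (t - 1) (1 + t)] and [1 + t] times the norm of the
    subgroup is the norm of the group, applying [P] to every second entry yields a zigzag again. *)
Lemma zigzag_restrict b n (z : D n.+1) a : zigzag dD TD b z a ->
  zigzag dC TC b (if b then j n.+1 z else P n.+1 (j n.+1 z))
    (if b (+) odd n then j 0 a else P 0 (j 0 a)).
Proof.
elim: n b z => [|n IHn] b z /=; first by case: b => <-; rewrite ?dP dj.
rewrite addbN -addNb; case: b => -[y dz /IHn/= zy].
  by exists (P n.+1 (j n.+1 y)) => //; rewrite dj dz jT1.
by exists (j n.+1 y) => //; rewrite dP dj dz jT0.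
Qed.

End Restriction.

(** * Pushing a zigzag into an acyclic part of fixed chains *)

Section Comparison.
Variables (C E : nat -> zmodType).
Variables (dC : forall n, {additive C n.+1 -> C n}) (dE : forall n, {additive E n.+1 -> E n}).
Variables (TC : bool -> forall n, {additive C n -> C n}).
Variables (TE : bool -> forall n, {additive E n -> E n}).
Variables (g : forall n, {additive C n -> E n}).
Hypothesis dg : forall n x, dE n (g n.+1 x) = g n (dC n x).
Hypothesis gT : forall b n x, g n (TC b n x) = TE b n (g n x).
Hypothesis dTE : forall b n x, dE n (TE b n.+1 x) = TE b n (dE n x).
Hypothesis TTE : forall b n x, TE b n (TE (~~ b) n x) = 0.
Hypothesis dE_exact : forall n x, dE n x = 0 -> exists y, x = dE n.+1 y.
Variables (P : forall n, {additive E n -> E n}).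
Hypothesis dP : forall n x, dE n (P n.+1 x) = P n (dE n x).
Hypothesis PB : forall n x, P n x - TE true n x = x *+ 2.
Variables (S : forall n, E n.+1 -> Prop).
Hypothesis S_P : forall n x, @S n x -> S (P n.+1 x).
Hypothesis S_T : forall n x, @S n x -> S (TE true n.+1 x).
Hypothesis T_P : forall n x, @S n x -> TE true n.+1 (P n.+1 x) = 0.
Hypothesis P_T : forall n x, @S n x -> P n.+1 (TE true n.+1 x) = 0.
Hypothesis N_P : forall n x, @S n x -> TE false n.+1 x = P n.+1 x *+ 2.
Hypothesis S_exact : forall n x, @S n x -> dE n x = 0 ->
  exists2 y, S y & x = dE n.+1 y.
Hypothesis S_point : forall a, exists e (c : int),
  [/\ @S 0 e, dE 0 (TE true 1 e) = 0 & dE 0 e *~ c = a].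

(** On fixed chains this is the operator [TE (~~ b)] applied one level up, with the factor 2 removed
    from the norm. *)
Let twist (b : bool) n : E n -> E n := if b then P n else TE true n.

(** By induction, the twist of the fixed chain [v] one level down is a fixed cycle, so it bounds a
    fixed chain, which is the next representative. The multiplicity doubles at each passage through
    the norm, and the first one occurs at [n = 2]. *)
Lemma zigzag_fixed b n (z : C n.+1) a : b = odd n -> zigzag dC TC b z a ->
  exists v (c : int) w w', [/\ S v, dE n (twist b v) = 0, (1 < n)%N -> exists c', c = c' * 2 &
    g n.+1 z = v *~ c + dE n.+1 w + TE b n.+1 w'].
Proof.
elim: n b z => [|n IHn] b z /= bE.
  move=> dz; have [e [c [Se de ec]]] := S_point (g 0 a).
  have [|w wE] := @dE_exact 0 (g 1 z - e *~ c); first by rewrite raddfB raddfMz /= dg dz ec subrr.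
  by exists e, c, w, 0; split; rewrite ?bE// raddf0 addr0 -wE addrC subrK.
move=> [y dz /IHn[|v [c [w [w' [Sv dv cE yE]]]]]]; first by rewrite bE negbK.
have dgz : dE n.+1 (g n.+2 z) = TE b n.+1 v *~ c + dE n.+1 (TE b n.+2 w).
  by rewrite dg dz gT yE !raddfD TTE addr0 raddfMz dTE.
have [v' [c' [Sv' dv' c'E vE]]] : exists v' (c' : int), [/\ S v', dE n.+1 (twist b v') = 0,
    (1 < n.+1)%N -> exists c1, c' = c1 * 2 & TE b n.+1 v *~ c = dE n.+1 v' *~ c'].
  have St : S (twist (~~ b) v) by rewrite /twist; case: (b) => /=; [exact: S_T|exact: S_P].
  have [v' Sv' vE] := S_exact St dv; exists v'.
  move: vE dv cE dgz; rewrite /twist bE; case: (boolP (odd n)) => /= odd_n vE dv cE dgz.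
    (* The operator applied to [v] is the norm here, and on fixed chains it is [2 P]. *)
    exists (c * 2); split=> //; [by rewrite dTE -vE T_P| by move=> _; exists c|].
    by rewrite N_P// vE pmulrn -mulrzA mulrC.
  exists c; split=> //; first by rewrite dP -vE P_T.
  (* Since [n] is even, [1 < n.+1] already forces [1 < n]. *)
  move=> n1; apply: cE.
  case: n {z y dz v w w' yE Sv dv dgz St v' Sv' vE IHn bE} odd_n n1 => // -[|]//.
  by rewrite vE.
have [|w'' wE] := @dE_exact n.+1 (g n.+2 z - v' *~ c' - TE b n.+2 w).
  by rewrite !raddfB raddfMz /= dgz vE addrAC addrK subrr.
exists v', c', w'', w; split=> //.
by rewrite -wE -addrA subrK addrC subrK.
Qed.

(** The multiplicity of [v] is even and [P v] bounds, so [2 v = P v - (t - 1) v] is a boundary plus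
    an image of [t - 1]. *)
Lemma zigzag_comparison_vanish n (z : C n.+1) a : (1 < n)%N -> odd n ->
  zigzag dC TC true z a -> exists w w', g n.+1 z = dE n.+1 w + TE true n.+1 w'.
Proof.
move=> n1 odd_n /zigzag_fixed[//|v [c [w [w' [Sv dv /(_ n1)[c' ->] ->]]]]].
have [v' _ vE] := S_exact (S_P Sv) dv.
have v2 : v *~ (c' * 2) = (dE n.+1 v' - TE true n.+1 v) *~ c'.
  by rewrite -vE PB pmulrn -mulrzA mulrC.
exists (v' *~ c' + w), (w' - v *~ c').
rewrite v2 !raddfD raddfN !raddfMz/= mulrzBl mulNrz -!addrA; congr (_ + _).
by rewrite addrCA; congr (_ + _); rewrite addrC.
Qed.

End Comparison.

(** * The operators [t - 1] and norm of a cyclic action *)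

Section CyclicOperators.
Variables (V : zmodType) (f : {additive V -> V}) (m : nat).

Definition orbit_diff (x : V) : V := f x - x.
Definition orbit_sum (x : V) : V := \sum_(j < m) iter j f x.

Lemma orbit_diff_is_zmod_morphism : zmod_morphism orbit_diff.
Proof. by move=> x y; rewrite /orbit_diff raddfB opprD addrACA -opprD. Qed.
HB.instance Definition _ :=
  GRing.isZmodMorphism.Build _ _ orbit_diff orbit_diff_is_zmod_morphism.

Lemma orbit_sum_is_zmod_morphism : zmod_morphism orbit_sum.
Proof.
move=> x y; rewrite /orbit_sum -sumrB; apply: eq_bigr => j _.
by elim: (val j) => //= k ->; rewrite raddfB.
Qed.
HB.instance Definition _ :=
  GRing.isZmodMorphism.Build _ _ orbit_sum orbit_sum_is_zmod_morphism.

Definition cyclic_op (b : bool) : {additive V -> V} :=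
  if b then (orbit_diff : {additive V -> V}) else (orbit_sum : {additive V -> V}).

(** Both composites telescope to [f^m x - x]. *)
Lemma cyclic_opK (b : bool) x : (forall y, iter m f y = y) ->
  cyclic_op b (cyclic_op (~~ b) x) = 0.
Proof.
move=> fm; have tel k : \sum_(j < k) f (iter j f x) - \sum_(j < k) iter j f x = iter k f x - x.
  elim: k => [|k IHk]; first by rewrite !big_ord0 !subrr.
  by rewrite !big_ord_recr opprD /= addrACA IHk addrAC addrCA subrr addr0 addrC.
case: b; rewrite /= /orbit_diff /orbit_sum.
  by rewrite raddf_sum tel fm subrr.
have -> : \sum_(j < m) iter j f (f x - x) = \sum_(j < m) (f (iter j f x) - iter j f x).
  apply: eq_bigr => j _; rewrite -iterS iterSr.
  by elim: (val j) (x) (f x) => //= k IH y z; rewrite IH raddfB.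
by rewrite sumrB tel fm subrr.
Qed.

End CyclicOperators.

Lemma cyclic_op_morph (V W : zmodType) (f : {additive V -> V}) (g : {additive W -> W})
    (h : {additive V -> W}) m b x : (forall y, h (f y) = g (h y)) ->
  h (cyclic_op f m b x) = cyclic_op g m b (h x).
Proof.
move=> hf; case: b; rewrite /= /orbit_diff /orbit_sum; first by rewrite raddfB hf.
rewrite raddf_sum; apply: eq_bigr => j _.
by elim: (val j) => //= k IHk; rewrite hf IHk.
Qed.

(** The combinatorial core of the vanishing of a double boundary: [(i, j) |-> (j + 1, i)] matches
    the pairs with [i <= j] with the remaining ones, and matched terms cancel. *)
Lemma big_face_face (V : zmodType) n (F : 'I_n.+3 -> 'I_n.+2 -> V) :
  (forall (i : 'I_n.+3) (j : 'I_n.+2), (i <= j)%N -> F (lift ord0 j) (inord i) = - F i j) ->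
  \sum_i \sum_j F i j = 0.
Proof.
move=> FN; rewrite pair_big /= (bigID (fun p : 'I_n.+3 * 'I_n.+2 => (p.1 <= p.2)%N)) /= addrC.
pose h (p : 'I_n.+3 * 'I_n.+2) : 'I_n.+3 * 'I_n.+2 := (lift ord0 p.2, inord p.1).
pose h' (p : 'I_n.+3 * 'I_n.+2) : 'I_n.+3 * 'I_n.+2 := (inord p.2, inord p.1.-1).
have hK (p : 'I_n.+3 * 'I_n.+2) : ~~ (p.1 <= p.2)%N -> h (h' p) = p.
  case: p => i j /= ij; have := ltn_ord i; have := ltn_ord j => jn ni.
  by rewrite /h /h' /=; congr pair; apply/val_inj; rewrite /= !inordK /bump //=; lia.
rewrite (reindex_onto h h' hK) /=.
(* After reindexing, the range asks for [h p] to lie off the range [i <= j] and for [h' (h p) = p];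
   together these amount to [i <= j] for [p]. *)
rewrite (eq_bigl (fun p : 'I_n.+3 * 'I_n.+2 => (p.1 <= p.2)%N)); last first.
  case=> i j; have := ltn_ord i; have := ltn_ord j => jn ni /=.
  rewrite /h /h' /= /bump leq0n /= add1n; case: (leqP i j) => ij.
    rewrite inordK; last exact: leq_ltn_trans ij _.
    rewrite -ltnNge ltnS ij /=; apply/eqP; congr pair; apply/val_inj; rewrite /= ?inordK//.
  apply/negbTE/negP => /andP[+ /eqP[iE _]].
  have {}iE : nat_of_ord i = (inord i : 'I_n.+2).
    by rewrite -[in LHS]iE inordK//; exact: leq_trans (ltn_ord _) _.
  by rewrite -iE; move: ij; lia.
by rewrite -big_split big1//= => -[i j] /= ij; rewrite FN// addNr.
Qed.

(** * The augmented singular chain complex *)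

Section Augmented.
Variable R : realType.
Implicit Types X Y Z : topologicalType.

Definition chain_map (X Y : topologicalType) (f : continuousType X Y) n :
    chain R X n -> chain R Y n :=
  lift_chain (fun s : singular R X n => gen (f \o s : singular R Y n)).

Lemma chain_map_is_zmod_morphism X Y f n : zmod_morphism (@chain_map X Y f n).
Proof. exact: lift_chain_is_zmod_morphism. Qed.
HB.instance Definition _ X Y f n :=
  GRing.isZmodMorphism.Build _ _ (@chain_map X Y f n) (@chain_map_is_zmod_morphism X Y f n).

Lemma chain_map_gen X Y (f : continuousType X Y) n (s : singular R X n) :
  chain_map f (gen s) = gen (f \o s : singular R Y n).
Proof. exact: lift_chain_gen. Qed.

Lemma boundary_gen X n (s : singular R X n.+1) :
  boundary (gen s) = \sum_(i < n.+2) (-1) ^+ i *: gen (sface i s).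
Proof. exact: lift_chain_gen. Qed.

Lemma boundary_chain_map X Y (f : continuousType X Y) n (c : chain R X n) :
  boundary (chain_map f c) = chain_map f (boundary c).
Proof.
case: n c => [|n] c; first by rewrite raddf0.
apply: (@eq_additive_chain _ _ _ _ (@boundary R Y n.+1 \o @chain_map _ _ f n.+1)
  (@chain_map _ _ f n \o @boundary R X n.+1)) => s /=.
rewrite chain_map_gen !boundary_gen raddf_sum; apply: eq_bigr => i _.
rewrite raddfZsign /= chain_map_gen; congr (_ *: gen _).
exact/continuousEP.
Qed.

Lemma chain_map_comp X Y Z (f : continuousType X Y) (g : continuousType Y Z) n (c : chain R X n) :
  chain_map g (chain_map f c) = chain_map (g \o f : continuousType X Z) c.
Proof.
apply: (@eq_additive_chain _ _ _ _ (@chain_map _ _ g n \o @chain_map _ _ f n)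
  (@chain_map _ _ (g \o f) n)) => s /=.
rewrite !chain_map_gen; congr gen; exact/continuousEP.
Qed.

Lemma eq_chain_map X Y (f g : continuousType X Y) n : f =1 g ->
  @chain_map _ _ f n =1 chain_map g (n := n).
Proof. by move=> /continuousEP ->. Qed.

Lemma chain_map_id X (f : continuousType X X) n (c : chain R X n) :
  f =1 id -> chain_map f c = c.
Proof.
move=> fid; apply: (@eq_additive_chain _ _ _ _ (@chain_map _ _ f n) idfun) => s /=.
by rewrite chain_map_gen; congr gen; apply/continuousEP => x; exact: fid.
Qed.

Definition aug (X : topologicalType) (k : nat) : zmodType :=
  if k is n.+1 then chain R X n else int.

Definition degree X : chain R X 0 -> int := lift_chain (fun=> 1 : int^o).
Lemma degree_is_zmod_morphism X : zmod_morphism (@degree X).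
Proof. exact: (@lift_chain_is_zmod_morphism R X int^o). Qed.
HB.instance Definition _ X :=
  GRing.isZmodMorphism.Build _ _ (@degree X) (@degree_is_zmod_morphism X).
Lemma degree_gen X (s : singular R X 0) : degree (gen s) = 1.
Proof. exact: (@lift_chain_gen R X int^o). Qed.

Definition aug_d X k : {additive aug X k.+1 -> aug X k} :=
  match k return {additive aug X k.+1 -> aug X k} with
  | n.+1 => @boundary R X n.+1
  | 0 => @degree X
  end.

Definition aug_map X Y (f : continuousType X Y) k : {additive aug X k -> aug Y k} :=
  match k return {additive aug X k -> aug Y k} with
  | n.+1 => @chain_map X Y f n
  | 0 => idfun
  end.

Arguments aug_d {X} k.
Arguments aug_map {X Y} f k.

Lemma aug_d_map X Y (f : continuousType X Y) k (c : aug X k.+1) :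
  aug_d k (aug_map f k.+1 c) = aug_map f k (aug_d k c).
Proof.
case: k c => [|n] c; last exact: (@boundary_chain_map X Y f n.+1 c).
apply: (@eq_additive_chain _ _ int^o _ (@degree Y \o @chain_map _ _ f 0) (@degree X)) => s /=.
by rewrite chain_map_gen !degree_gen.
Qed.

Lemma aug_map_comp X Y Z (f : continuousType X Y) (g : continuousType Y Z) k c :
  aug_map g k (aug_map f k c) = aug_map (g \o f : continuousType X Z) k c.
Proof. by case: k c => //= n c; exact: chain_map_comp. Qed.

Lemma eq_aug_map X Y (f g : continuousType X Y) k : f =1 g -> aug_map f k =1 aug_map g k.
Proof. by move=> fg; case: k => //= n; exact: eq_chain_map. Qed.

Lemma aug_map_id X (f : continuousType X X) k c : f =1 id -> aug_map f k c = c.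
Proof. by case: k c => //= n c; exact: chain_map_id. Qed.

Lemma face_fun_lift n (i : 'I_n.+2) (t : 'rV[R]_n.+1) k : face_fun i t 0 (lift i k) = t 0 k.
Proof. by rewrite mxE liftK. Qed.

Lemma face_fun_id n (i : 'I_n.+2) (t : 'rV[R]_n.+1) : face_fun i t 0 i = 0.
Proof. by rewrite mxE unlift_none. Qed.

(** Both composites insert zeros at the positions [i] and [j + 1]. *)
Lemma face_face n (i : 'I_n.+3) (j : 'I_n.+2) (t : std_simplex R n) : (i <= j)%N ->
  face i (face j t) = face (lift ord0 j) (face (inord i : 'I_n.+2) t).
Proof.
move=> ij; apply/val_inj/rowP => k /=.
have iE : nat_of_ord (inord i : 'I_n.+2) = i by rewrite inordK//; exact: leq_ltn_trans ij _.
have [k' ->|->] := unliftP i k; last first.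
  have e : i = lift (lift ord0 j) (inord i).
    by apply/val_inj; rewrite /= iE /bump /=; lia.
  by rewrite face_fun_id [X in face_fun (lift _ _) _ _ X]e face_fun_lift face_fun_id.
have [k'' ->|->] := unliftP j k'; last first.
  have e : lift i j = lift ord0 j by apply/val_inj; rewrite /= /bump /=; lia.
  by rewrite face_fun_lift [X in face_fun (lift _ _) _ _ X]e !face_fun_id.
have e : lift i (lift j k'') = lift (lift ord0 j) (lift (inord i) k'').
  by apply/val_inj; rewrite /= iE /bump /=; lia.
by rewrite !face_fun_lift [X in face_fun (lift _ _) _ _ X]e !face_fun_lift.
Qed.

Lemma boundaryK X n (c : chain R X n) : boundary (boundary c) = 0.
Proof.
case: n c => [|[|n]] c; rewrite ?raddf0//.
apply: (@eq_additive_chain _ _ _ _ (@boundary R X n.+1 \o @boundary R X n.+2) \0) => s /=.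
rewrite boundary_gen raddf_sum /=.
under eq_bigr do rewrite raddfZsign /= boundary_gen scaler_sumr.
apply: (@big_face_face (chain R X n) n
  (fun i j => (-1) ^+ i *: ((-1) ^+ j *: gen (sface j (sface i s))))) => i j ij.
rewrite !scalerA -!exprD.
have -> : sface (inord i) (sface (lift ord0 j) s) = sface j (sface i s).
  by apply/continuousEP => t /=; rewrite (face_face _ ij).
by rewrite inordK ?(leq_ltn_trans ij)// lift0 addSn exprS mulN1r scaleNr addnC.
Qed.

Lemma aug_dd X k (c : aug X k.+2) : aug_d k (aug_d k.+1 c) = 0.
Proof.
case: k c => [|n] c; last exact: (@boundaryK X n.+2 c).
apply: (@eq_additive_chain _ _ int^o _ (@degree X \o @boundary R X 1) \0) => s /=.
rewrite boundary_gen !big_ord_recl big_ord0 /= raddfD raddfD/= !raddfZsign/=.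
rewrite !(@lift_chain_gen R X int^o).
by rewrite raddf0.
Qed.

End Augmented.
Arguments degree : simpl never.
Arguments aug_d {R X} k.
Arguments aug_map {R X Y} f k.

(** * Chains of a free cyclic action *)

Section PartialSum.
Variables (V : zmodType) (F : nat -> V).

Definition partial_sum k := \sum_(j < k) F j.

Lemma partial_sum0 : partial_sum 0 = 0.
Proof. exact: big_ord0. Qed.

Lemma partial_sumS k : partial_sum k.+1 = partial_sum k + F k.
Proof. exact: big_ord_recr. Qed.

Lemma partial_sum_single k p a : (p < k)%N ->
  (forall j, (j < k)%N -> F j = if j == p then a else 0) -> partial_sum k = a.
Proof.
move=> pk Fa; rewrite /partial_sum (bigD1 (Ordinal pk)) //= Fa// eqxx big1 ?addr0// => j jp.
by rewrite Fa// (negbTE (_ : nat_of_ord j != p))//; move: jp; rewrite -val_eqE.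
Qed.

End PartialSum.

Lemma raddf_partial_sum (V W : zmodType) (f : {additive V -> W}) F k :
  f (partial_sum F k) = partial_sum (f \o F) k.
Proof. exact: raddf_sum. Qed.

Lemma eq_partial_sum (V : zmodType) (F G : nat -> V) k : F =1 G ->
  partial_sum F k = partial_sum G k.
Proof. by move=> FG; apply: eq_bigr => j _; exact: FG. Qed.

Section FreeSimplices.
Variables (R : realType) (X Y : topologicalType) (n m : nat).
Variables (t : continuousType X X) (q : continuousType X Y).
Local Notation simplex := (singular R X n).
Let shift (s : simplex) : simplex := t \o s.
Hypothesis q_inv : forall x, q (t x) = q x.
Hypothesis t_order : forall x, iter m t x = x.
Hypothesis t_free : forall (s : simplex) k, (k < m)%N -> iter k shift s = s -> k = 0%N.
Hypothesis q_fibre : forall s s' : simplex, q \o s =1 q \o s' ->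
  exists2 k, (k < m)%N & s' = iter k shift s.

Let fibre (s : simplex) : pred simplex := fun s' => `[< q \o s' =1 q \o s >].
(** The chosen simplices form a basis of the chains over the group ring; [index] below is the
    exponent of a simplex relative to its basis element. *)
Let rep (s : simplex) : simplex := choose (fibre s) s.

Let repP s : q \o rep s =1 q \o s.
Proof. by have /asboolP := @chooseP _ (fibre s) s (asboolT (frefl _)). Qed.

Let rep_eq (s s' : simplex) : q \o s =1 q \o s' -> rep s = rep s'.
Proof.
move=> e; rewrite /rep (@eq_choose simplex (fibre s) (fibre s')).
  by apply: choose_id; apply/asboolP.
by move=> s1; apply/asboolP/asboolP => h x; rewrite h e.
Qed.

Let index_exists s : {k | (k < m)%N /\ s = iter k shift (rep s)}.
Proof. by apply: cid; have [k] := q_fibre (repP s); exists k. Qed.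

Let index s : nat := sval (index_exists s).

Let shift_fun k s x : (iter k shift s : simplex) x = iter k t (s x).
Proof. by elim: k => //= k ->. Qed.

Let shift_order s : iter m shift s = s.
Proof. by apply/continuousEP => x; rewrite shift_fun t_order. Qed.

Let rep_shift k s : rep (iter k shift s) = rep s.
Proof.
apply: rep_eq => x /=; rewrite shift_fun.
by elim: k => //= k <-; rewrite q_inv.
Qed.

Let shift_inj s j k : (j < m)%N -> (k < m)%N -> iter j shift s = iter k shift s -> j = k.
Proof.
wlog jk : j k / (j <= k)%N => [hw|].
  move=> jm km e; case: (leqP j k) => jk; first exact: hw.
  by apply/esym; apply: hw => //; exact: ltnW.
move=> jm km; rewrite -{1}(subnK jk) iterD => e.
have /t_free kj0 : iter (k - j) shift (iter j shift s) = iter j shift s by rewrite -e.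
by have := kj0 (leq_ltn_trans (leq_subr _ _) km); lia.
Qed.

Let indexE k s : (k < m)%N -> rep s = s -> index (iter k shift s) = k.
Proof.
move=> km rs; rewrite /index; case: index_exists => k' /= [k'm].
by rewrite rep_shift rs => /shift_inj <-.
Qed.

Let repK s : rep (rep s) = rep s.
Proof. exact/rep_eq/repP. Qed.

Let simplexE s : exists2 k, (k < m)%N & s = iter k shift (rep s).
Proof. by case: (index_exists s) => k []; exists k. Qed.

Local Notation act := (chain_map t (n := n) : {additive chain R X n -> chain R X n}).

Let iter_act k s : iter k act (gen s) = gen (iter k shift s).
Proof. by elim: k => //= k ->; rewrite chain_map_gen. Qed.

Let orbit_sum_gen s : orbit_sum act m (gen s) = partial_sum (fun j => gen (iter j shift s)) m.
Proof. by apply: eq_bigr => j _; exact: iter_act. Qed.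

(** Together with [multiplier], a contracting homotopy of the periodic complex with maps [t - 1] and
    norm. On [t^k r], with [r] a basis element and [k < m], it is [r + t r + ... + t^(k-1) r]. *)
Definition primitive : chain R X n -> chain R X n :=
  lift_chain (fun s : simplex => partial_sum (fun j => gen (iter j shift (rep s))) (index s)).
Arguments primitive : simpl never.
HB.instance Definition _ := GRing.isZmodMorphism.Build _ _ primitive
  (@lift_chain_is_zmod_morphism R X _ n _).

Definition multiplier : chain R X n -> chain R X n :=
  lift_chain (fun s : simplex => if (index s).+1 == m then gen (rep s) else 0).
Arguments multiplier : simpl never.
HB.instance Definition _ := GRing.isZmodMorphism.Build _ _ multiplier
  (@lift_chain_is_zmod_morphism R X _ n _).

Definition choose_lift : chain R Y n -> chain R X n :=
  lift_chain (fun s : singular R Y n =>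
    if pselect (exists s' : simplex, q \o s' =1 s) is left e
    then gen (rep (projT1 (cid e))) else 0).
HB.instance Definition _ := GRing.isZmodMorphism.Build _ _ choose_lift
  (@lift_chain_is_zmod_morphism R Y _ n _).

(** Replaces a simplex by its representative; the detour through the chains of [Y] makes it vanish
    on the kernel of [chain_map q]. *)
Definition normalize : chain R X n -> chain R X n := choose_lift \o chain_map q (n := n).
Arguments normalize : simpl never.
HB.instance Definition _ := GRing.Additive.on normalize.

Let normalize_gen s : normalize (gen s) = gen (rep s).
Proof.
rewrite /normalize /= chain_map_gen /choose_lift lift_chain_gen.
case: pselect => [e|[]]; last by exists s.
by case: (cid e) => s' /= e'; congr gen; exact: rep_eq.
Qed.

Let diff_primitive c : orbit_diff act (primitive c) = c - normalize c.
Proof.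
apply: (@eq_additive_chain _ _ _ _ (orbit_diff act \o primitive) (idfun \- normalize)) => s /=.
rewrite normalize_gen /primitive lift_chain_gen /index; case: index_exists => k /= [km sE].
rewrite /orbit_diff raddf_partial_sum /=; move: sE; set r := rep s => sE; rewrite [in RHS]sE.
rewrite (eq_partial_sum (G := fun j => gen (iter j.+1 shift r))) => [|j]; last exact: chain_map_gen.
elim: k {km sE} => [|k IHk]; first by rewrite !partial_sum0 !subrr.
by rewrite !partial_sumS opprD /= addrACA IHk addrC addrA subrK.
Qed.

Let primitive_diff c : primitive (orbit_diff act c) = c - orbit_sum act m (multiplier c).
Proof.
apply: (@eq_additive_chain _ _ _ _ (primitive \o orbit_diff act)
  (idfun \- (orbit_sum act m \o multiplier))) => s /=.
rewrite /orbit_diff raddfB /= chain_map_gen.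
have [k km sE] := simplexE s; set r := rep s in sE.
have rr : rep r = r by exact: repK.
have -> : (t \o s : simplex) = iter k.+1 shift r by rewrite [in LHS]sE.
rewrite /primitive /multiplier !lift_chain_gen rep_shift.
have -> : index s = k by rewrite sE indexE.
have [kS|/eqP kS] := eqVneq k.+1 m.
  (* Wrap-around: [t s] is [r], of index 0, and [primitive] of [s] lacks only [s] from the whole
     orbit sum. *)
  rewrite kS shift_order (_ : index r = 0%N); last by rewrite (@indexE 0)//; lia.
  rewrite partial_sum0 -/r sub0r orbit_sum_gen -kS.
  by rewrite partial_sumS -sE opprD addrCA subrr addr0.
rewrite indexE//; last by lia.
by rewrite -/r rr partial_sumS raddf0 subr0 -sE addrC addKr.
Qed.

Let multiplier_sum c : multiplier (orbit_sum act m c) = normalize c.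
Proof.
apply: (@eq_additive_chain _ _ _ _ (multiplier \o orbit_sum act m) normalize) => s /=.
rewrite normalize_gen orbit_sum_gen raddf_partial_sum.
have [k km sE] := simplexE s; set r := rep s in sE *.
have rr : rep r = r by exact: repK.
(* Exactly one translate of [s] has the index [m - 1] that [multiplier] detects, namely the one by
   [t^(m - 1 - k)]. *)
refine (@partial_sum_single _ _ m (m.-1 - k) (gen r) _ _) => [|j jm]; first by lia.
rewrite /= /multiplier lift_chain_gen rep_shift -/r sE -iterD.
case: (ltnP (j + k) m) => jk.
  by rewrite indexE//; case: eqP; case: eqP => //; lia.
have -> : iter (j + k) shift r = iter (j + k - m) shift r.
  by rewrite -{1}(subnK jk) iterD shift_order.
by rewrite indexE//; [case: eqP; case: eqP => //; lia|lia].
Qed.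

Lemma orbit_sum_exact (c : chain R X n) : orbit_diff act c = 0 -> exists y, c = orbit_sum act m y.
Proof.
by move=> c0; exists (multiplier c); apply/eqP; rewrite -subr_eq0 -primitive_diff c0 raddf0.
Qed.

Lemma orbit_diff_exact (c : chain R X n) : orbit_sum act m c = 0 -> exists y, c = orbit_diff act y.
Proof.
by move=> c0; exists (primitive c); rewrite diff_primitive -multiplier_sum c0 raddf0 subr0.
Qed.

Lemma orbit_diff_kernel (c : chain R X n) : chain_map q c = 0 -> exists y, c = orbit_diff act y.
Proof.
by move=> c0; exists (primitive c); rewrite diff_primitive /normalize /= c0 raddf0 subr0.
Qed.

End FreeSimplices.

(** * Topology of the standard simplices *)

Lemma continuous_rV (T U : topologicalType) n (f : T -> 'rV[U]_n) x :
  (forall j, {for x, continuous (fun y => f y 0 j)}) -> {for x, continuous f}.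
Proof.
move=> cf A [P nP sPA].
have : \forall y \near x, forall j, P 0 j (f y 0 j).
  by apply: filter_forall => j; apply: cf; exact: nP.
by apply: filterS => y Py; apply: sPA => i j; rewrite (ord1 i); exact: Py.
Qed.

Section Clamp.
Variable R : realType.

(** This retraction of the line onto [[0, 1]] turns homotopies into continuous maps on a whole
    product with [R]. *)
Definition clamp (s : R) : R := Num.max 0 (Num.min s 1).

Lemma clamp_continuous : continuous clamp.
Proof.
move=> s; have c0 : {for s, continuous ((fun=> 0) \max ((id : R -> R^o) \min fun=> 1))}.
  apply: continuous_max; first exact: cvg_cst.
  by apply: continuous_min; [exact: cvg_id|exact: cvg_cst].
exact: c0.
Qed.

Lemma clamp_itv s : 0 <= clamp s <= 1.
Proof. by rewrite /clamp le_max lexx /= ge_max ler01 ge_min lexx orbT. Qed.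

Lemma clamp_id s : 0 <= s <= 1 -> clamp s = s.
Proof. by case/andP=> s0 s1; rewrite /clamp (min_idPl s1) (max_idPr s0). Qed.

Lemma clamp0 : clamp 0 = 0.
Proof. by rewrite clamp_id// lexx ler01. Qed.

Lemma clamp1 : clamp 1 = 1.
Proof. by rewrite clamp_id// lexx ler01. Qed.

End Clamp.

Section Simplex.
Variables (R : realType) (n : nat).
Local Notation simplex := (std_simplex R n).

Lemma simplex_coord_continuous j : continuous (fun t : simplex => val t 0 j).
Proof.
move=> t; apply: (@continuous_comp _ _ _ (val : simplex -> 'rV_n.+1) (fun v => v 0 j)).
  exact: initial_continuous.
exact: coord_continuous.
Qed.

Lemma continuous_simplex (T : topologicalType) (f : T -> simplex) x :
  (forall j, {for x, continuous (fun y => val (f y) 0 j)}) -> {for x, continuous f}.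
Proof.
move=> cf; have : {for x, continuous (val \o f)} by apply: continuous_rV.
move=> cvf U [_ [[C oC <-] /= Cx CU]].
have : nbhs (val (f x)) C by exact: open_nbhs_nbhs.
move=> Cn; have : nbhs x ((val \o f) @^-1` C) by exact: (cvf _ Cn).
by apply: filterS => y; exact: CU.
Qed.

Lemma simplex_ge0 (t : simplex) j : 0 <= val t 0 j.
Proof. by case: (set_mem (valP t)). Qed.

Lemma simplex_sum (t : simplex) : \sum_j val t 0 j = 1.
Proof. by case: (set_mem (valP t)). Qed.

Lemma simplex_le1 (t : simplex) j : val t 0 j <= 1.
Proof.
rewrite -(simplex_sum t) (bigD1 j) //= lerDl; apply: sumr_ge0 => k _; exact: simplex_ge0.
Qed.

Lemma simplex_compact : compact [set: simplex].
Proof.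
have : compact (std_simplex R n : set 'rV_n.+1).
  apply: bounded_closed_compact.
    exists 1; split=> // M M1 v [v0 v1] /=.
    rewrite [leLHS]mx_normrE; apply: bigmax_le => [|[i j] _ /=]; first by rewrite ltW// (lt_trans ltr01).
    rewrite (ord1 i) ger0_norm//; apply/ltW/(le_lt_trans _ M1).
    by rewrite -v1 (bigD1 j) //= lerDl sumr_ge0.
  rewrite (_ : std_simplex R n = (\bigcap_j (fun v : 'rV_n.+1 => v 0 j) @^-1` [set x | 0 <= x])
      `&` (fun v : 'rV_n.+1 => \sum_j v 0 j) @^-1` [set x | x = 1]).
    apply: closedI; first apply: closed_bigI => j _.
      by apply: preimage_closed; [move=> v _; exact: coord_continuous|exact: closed_ge].
    apply: preimage_closed; last exact: closed_eq.
    move=> v _; apply: (continuous_big add_continuous) => j _.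
    exact: coord_continuous.
  by apply/seteqP; split=> v [v0 v1]; split=> // j; [move=> _|]; exact: v0.
(* Compactness passes from the subset to the subtype: a filter is pushed forward along [val] and its
   cluster point pulled back. *)
move=> cS F FF _.
have [|v [Sv Fv]] := cS (val @ F) _.
  by apply: (@filterE _ F) => t; exact: set_mem (valP t).
exists (exist _ v (mem_set Sv)); split=> // A B FA [_ [[C oC <-] Cv CB]].
have [||w [[t At <-] Ct]] := Fv (val @` A) C.
- by apply: (@filterS _ F _ A) FA => t At; exists t.
- exact: open_nbhs_nbhs.
by exists t; split=> //; exact: CB.
Qed.

Lemma vertex_subproof : (delta_mx 0 0 : 'rV[R]_n.+1) \in std_simplex R n.
Proof.
apply/mem_set; split=> [j|]; first by rewrite mxE ler0n.
by rewrite (bigD1 0)//= mxE !eqxx big1 ?addr0// => j /negbTE j0; rewrite mxE j0 andbF.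
Qed.
Definition vertex : simplex := exist _ (delta_mx 0 0) vertex_subproof.

Lemma segment_subproof (p : simplex) (s : R) :
  (1 - clamp s) *: val vertex + clamp s *: val p \in std_simplex R n.
Proof.
have /andP[s0 s1] := clamp_itv s.
apply/mem_set; split=> [j|].
  by rewrite !mxE addr_ge0// mulr_ge0 ?subr_ge0// ?ler0n// simplex_ge0.
under eq_bigr do rewrite mxE [X in X + _]mxE [X in _ + X]mxE.
by rewrite big_split -!mulr_sumr (simplex_sum vertex) (simplex_sum p) !mulr1 /= subrK.
Qed.
(** The straight path from vertex 0 to [p]; jointly in [p] it contracts the simplex, which reduces
    lifting simplices to lifting homotopies. *)
Definition segment (p : simplex) (s : R) : simplex :=
  exist _ ((1 - clamp s) *: val vertex + clamp s *: val p) (segment_subproof p s).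

Lemma segment_continuous : continuous (fun x : simplex * R => segment x.1 x.2).
Proof.
move=> x; apply: continuous_simplex => j /=.
have cs : {for x, continuous (fun x : simplex * R => clamp x.2)}.
  apply: (@continuous_comp _ _ _ snd (@clamp R)); [exact: cvg_snd|exact: clamp_continuous].
have cp : {for x, continuous (fun x : simplex * R => val x.1 0 j)}.
  apply: (@continuous_comp _ _ _ fst (fun t : simplex => val t 0 j)); first exact: cvg_fst.
  exact: simplex_coord_continuous.
rewrite (_ : (fun y => _) = fun y : simplex * R =>
  (1 - clamp y.2) * val vertex 0 j + clamp y.2 * val y.1 0 j); last first.
  by apply/funext => y; rewrite !mxE.
apply: cvgD; apply: cvgM => //; last exact: cvg_cst.
by apply: cvgB => //; exact: cvg_cst.
Qed.

Lemma segment0 p : segment p 0 = vertex.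
Proof. by apply/val_inj => /=; rewrite clamp0 subr0 scale1r scale0r addr0. Qed.

Lemma segment1 p : segment p 1 = p.
Proof. by apply/val_inj => /=; rewrite clamp1 subrr scale1r scale0r add0r. Qed.

End Simplex.

(** * Covering theory of the orbit projection *)

Lemma quot_proj_rel (X : topologicalType) (r : X -> X -> Prop) x y :
  quot_proj r x = quot_proj r y -> clos_refl_sym_trans X r x y.
Proof. by move=> /eqmodP/asboolP. Qed.

Section OrbitProjection.
Variables (gT : finGroupType) (G : {group gT}) (X : gspace G).
Local Notation orbit := (quot_proj (@orbit_rel gT G X)).

Lemma gact_cts g : g \in G -> continuous (gact g : X -> X).
Proof. exact: gact_continuous. Qed.

Lemma gactK g : g \in G -> cancel (gact g : X -> X) (gact g^-1%g).
Proof. by move=> Gg x; rewrite -gactM ?groupV// mulVg gact1. Qed.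

Lemma gactVK g : g \in G -> cancel (gact g^-1%g : X -> X) (gact g).
Proof. by move=> Gg x; rewrite -gactM ?groupV// mulgV gact1. Qed.

Lemma orbit_proj_gact g x : g \in G -> orbit (gact g x) = orbit x.
Proof. by move=> Gg; apply/esym/quot_proj_eq; exists g. Qed.

Lemma orbit_proj_rel x y : orbit x = orbit y -> exists2 g, g \in G & y = gact g x.
Proof.
move=> /quot_proj_rel; elim=> {x y} [//|x|x y _ [g Gg ->]|x y z _ [g Gg ->] _ [h Gh ->]].
- by exists 1%g; rewrite ?group1 ?gact1.
- by exists g^-1%g; rewrite ?groupV ?gactK.
- by exists (h * g)%g; rewrite ?groupM ?gactM.
Qed.

Lemma orbit_proj_open (U : set X) : open U -> open (orbit @` U).
Proof.
move=> oU; suff : open (orbit @^-1` (orbit @` U)) by [].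
rewrite (_ : _ @^-1` _ = \bigcup_(g in [set g | g \in G]) (gact g @^-1` U)).
  apply: bigcup_open => g Gg; move/continuousP: (gact_cts Gg); exact.
apply/seteqP; split=> [x [y Uy /orbit_proj_rel[g Gg xE]]|x [g Gg Ux]].
  by exists g^-1%g; rewrite /= ?groupV// xE gactK.
by exists (gact g x) => //; exact: orbit_proj_gact.
Qed.

Hypothesis X_hausdorff : hausdorff_space X.
Hypothesis X_free : forall g (x : X), g \in G -> gact g x = x -> g = 1%g.

(** These sets serve as the sheets of the covering [X -> X/G]. *)
Definition small (U : set X) := open U /\
  forall g x, g \in G -> U x -> U (gact g x) -> g = 1%g.

(** The Hausdorff property separates [x] from [g x] for each [g] other than 1. Working near [(x, x)]
    in [X * X], the finitely many conditions combine into one neighbourhood. *)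
Lemma small_nbhs x : exists2 U, small U & U x.
Proof.
have : nbhs ((x, x) : X * X) [set p | forall g, g \in G -> g != 1%g -> p.2 <> gact g p.1].
  apply: (@filter_forall _ gT (fun g p => g \in G -> g != 1%g -> p.2 <> gact g p.1)
    (nbhs (x, x)) _) => g.
  case: (boolP (g \in G)) => [Gg|_]; last by apply: filterE.
  have [_|g1] := eqVneq g 1%g; first by apply: filterE.
  move: X_hausdorff; rewrite open_hausdorff => /(_ x (gact g x)).
  have xgx : x != gact g x by apply/eqP => /esym/X_free gE; move: g1; rewrite gE ?eqxx.
  move=> /(_ xgx)[[A B] /= [/set_mem Ax /set_mem Bx] [oA oB /eqP AB]].
  have nB : nbhs x (gact g @^-1` B).
    by apply: (gact_cts Gg); exact: open_nbhs_nbhs.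
  exists (gact g @^-1` B, A); first by split=> //; exact: open_nbhs_nbhs.
  move=> [y z] /= [By Az] _ _ zE; suff : (A `&` B) z by rewrite AB.
  by split=> //; rewrite zE.
move=> [[U1 U2] /= [U1x U2x] U12]; exists (interior (U1 `&` U2)).
  split; first exact: open_interior.
  move=> g y Gg /interior_subset[U1y _] /interior_subset[_ U2y].
  have [//|g1] := eqVneq g 1%g.
  by case: (U12 (y, gact g y) (conj U1y U2y) g Gg g1).
exact: (filterI U1x U2x).
Qed.

Lemma small_inj U x y : small U -> U x -> U y -> orbit x = orbit y -> x = y.
Proof.
move=> [_ sU] Ux Uy /orbit_proj_rel[g Gg yE].
by rewrite yE (sU g x) ?gact1// -yE.
Qed.

Lemma small_translate U g : g \in G -> small U -> small (gact g @^-1` U).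
Proof.
move=> Gg [oU sU]; split.
  by move/continuousP: (gact_cts Gg); exact.
move=> h x Gh Ux Uhx; apply: (@conjg_inj _ g^-1%g); rewrite conj1g.
apply: (sU _ (gact g x)) => //; first by rewrite groupJ ?groupV.
by rewrite /conjg invgK -!gactM ?groupM ?groupV// -!mulgA mulVg mulg1 gactM.
Qed.

(** On a sheet the orbit projection is injective and open, so its local inverse is continuous. *)
Lemma local_lift_continuous (T : topologicalType) (U : set X) (b : T -> orbit_space X)
    (c : T -> X) p : small U -> {for p, continuous b} ->
  (\forall q \near p, U (c q) /\ orbit (c q) = b q) -> {for p, continuous c}.
Proof.
move=> sU cb cP W Wp; have [Up bp] := nbhs_singleton cP.
have oWU : open (orbit @` (W°  `&` U)).
  by apply: orbit_proj_open; apply: openI; [exact: open_interior|case: sU].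
have : nbhs (b p) (orbit @` (W° `&` U)).
  by apply: open_nbhs_nbhs; split=> //; rewrite -bp; exists (c p).
move=> /cb bW; apply: filterS2 cP bW => q [Uq bq] [y [Wy Uy]].
rewrite -bq => /(small_inj sU Uy Uq) yq; rewrite /= -yq; exact: interior_subset.
Qed.

(** Near each point [l'] is a translate of [l] by one fixed [g]; by freeness the set where the lifts
    agree is therefore open and closed. *)
Lemma orbit_lift_unique (T : topologicalType) (l l' : T -> X) t :
  connected [set: T] -> continuous l -> continuous l' -> orbit \o l =1 orbit \o l' ->
  l t = l' t -> l =1 l'.
Proof.
move=> cT cl cl' ll' lt.
have near_g (u : T) : exists2 g, g \in G & \forall v \near u, l' v = gact g (l v).
  have [g Gg lE] := orbit_proj_rel (ll' u); exists g => //.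
  have [U sU Uu] := small_nbhs (l u); have [oU _] := sU.
  have Ul : \forall v \near u, U (l v) by apply: cl; exact: open_nbhs_nbhs.
  have Ul' : \forall v \near u, U (gact g^-1%g (l' v)).
    apply: (cl' u (gact g^-1%g @^-1` U)); apply: (gact_cts (groupVr Gg)).
    by apply: open_nbhs_nbhs; split=> //; rewrite lE gactK.
  apply: filterS2 Ul Ul' => v Uv Uv'.
  by rewrite (small_inj sU Uv Uv') ?gactVK// orbit_proj_gact ?groupV//; exact: ll'.
have A_open : open [set u | l u = l' u].
  rewrite openE => u /= lu; have [g Gg] := near_g u.
  move=> gu; have g1 : g = 1%g.
    by apply: (X_free (x := l u)) => //; rewrite [RHS]lu; exact: esym (nbhs_singleton gu).
  by apply: filterS gu => v lv; rewrite /= lv g1 gact1.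
have A_closed : closed [set u | l u = l' u].
  rewrite -openC openE => u /= lu; have [g Gg gu] := near_g u.
  apply: filterS (gu) => v lv; rewrite /= lv => /esym /X_free gE; apply: lu.
  by rewrite (nbhs_singleton gu) gE ?gact1.
suff lT : [set u | l u = l' u] = setT by move=> u; rewrite -[l u = l' u]/([set u | l u = l' u] u) lT.
apply: cT; first by exists t.
  by exists [set u | l u = l' u]; rewrite ?setTI.
by exists [set u | l u = l' u]; rewrite ?setTI.
Qed.

Variable R : realType.

Lemma connected_line : connected [set: R].
Proof. by apply/connected_intervalP => x y _ _ z _. Qed.

Section Lift.
Variables (T : topologicalType) (F : T * R -> orbit_space X).
Hypothesis T_compact : compact [set: T].
Hypothesis F_continuous : continuous F.

Let evenly (e : R) (x : T * R) := exists V U, [/\ nbhs x.1 V, small U &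
  forall q u, V q -> x.2 <= u <= x.2 + e -> (orbit @` U) (F (q, u))].

(** A Lebesgue number: by compactness of [T * [0, 1]] one strip height serves all starting
    points. *)
Lemma evenly_near : \forall e \near 0^'+, forall p s, 0 <= s <= 1 -> evenly e (p, s).
Proof.
have K : compact ([set: T] `*` `[0, 1]%classic : set (T * R)).
  by apply: compact_setX => //; exact: segment_compact.
have := proj1 (compact_near_coveringP _) K R (0^'+) evenly _.
have loc x : ([set: T] `*` `[0, 1]%classic : set (T * R)) x ->
    \forall x' \near x & e \near 0^'+, evenly e x'.
  case: x => p0 s0 _; have [y Fy] := quot_proj_surj (F (p0, s0)).
  have [U sU Uy] := small_nbhs y.
  have : nbhs (p0, s0) (F @^-1` (orbit @` U)).
    apply: F_continuous; apply: open_nbhs_nbhs; split; first by apply: orbit_proj_open; case: sU.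
    by rewrite Fy; exists y.
  move=> [[V W] /= [Vp /nbhs_ballP[r /= r0 rW]] VW].
  (* One half of the radius is for the starting time, the other for the height of the strip. *)
  exists ((V°) `*` ball s0 (r / 2), [set e | e < r / 2]) => /=.
    split=> /=.
      exists (V°, ball s0 (r / 2)) => //=; split; first exact: nbhs_interior.
      by apply: nbhsx_ballx; rewrite divr_gt0.
    by apply: nbhs_right_lt; rewrite divr_gt0.
  move=> [[p s] e] /= [[Vp' sr] er]; exists V, U; split=> // q u Vq /= /andP[su us].
  apply: (VW (q, u)); split=> //=; apply: rW; move: sr er; rewrite /ball /= => sr er.
  by rewrite (splitr r) (le_lt_trans (ler_distD s _ _))// ltrD// ltr_norml; lra.
move=> /(_ _ loc); apply: filterS => e Ke p s s01.
by apply: (Ke (p, s)); split=> //=.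
Qed.

Variables (e : R) (s : R).
Hypothesis e_ge0 : 0 <= e.
Hypothesis evenly_e : forall p, evenly e (p, s).

(** Only the final stage of the lifted strip is constructed. A sheet through [a p] over the path
    [F (p, u)] determines the endpoint, and uniqueness of path lifts makes it independent of the
    sheet; continuity is then local. *)
Lemma lift_step (a : T -> X) : continuous a -> (forall p, orbit (a p) = F (p, s)) ->
  exists2 c : T -> X, continuous c & forall p, orbit (c p) = F (p, s + e).
Proof.
move=> ca aF.
pose good p U y := [/\ small U, U (a p), U y, orbit y = F (p, s + e) &
  forall u, s <= u <= s + e -> (orbit @` U) (F (p, u))].
have local p : exists V U, [/\ nbhs p V, small U, U (a p) &
    forall q u, V q -> s <= u <= s + e -> (orbit @` U) (F (q, u))].
  have [V [U [Vp sU VU]]] := evenly_e p.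
  have [||x Ux] := VU p s; [exact: nbhs_singleton|by rewrite lexx lerDl|].
  rewrite -aF => /esym/orbit_proj_rel[g Gg xE].
  exists V, (gact g @^-1` U); split=> //; first exact: small_translate.
    by rewrite /= -xE.
  move=> q u Vq su; have [y Uy yF] := VU q u Vq su; exists (gact g^-1%g y).
    by rewrite /= gactVK.
  by rewrite orbit_proj_gact ?groupV.
have good_ex p V U : small U -> U (a p) -> V p ->
    (forall q u, V q -> s <= u <= s + e -> (orbit @` U) (F (q, u))) -> exists y, good p U y.
  move=> sU Ua Vp VU; have [|y Uy yF] := VU p (s + e) Vp; first by rewrite lexx lerDl e_ge0.
  by exists y; split=> // u; exact: VU.
have good_unique p U U' y y' : good p U y -> good p U' y' -> y = y'.
  move=> [sU Ua Uy yF UF] [sU' Ua' Uy' yF' UF'].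
  pose gam (u : R) := F (p, s + clamp u * e).
  have gam_itv u : s <= s + clamp u * e <= s + e.
    by have /andP[c0 c1] := clamp_itv u; rewrite lerDl mulr_ge0//= lerD2l ler_piMl.
  have cgam : continuous gam.
    move=> u; apply: (@continuous_comp _ _ _ (fun u : R => (p, s + clamp u * e)) F); last exact: F_continuous.
    apply: (@cvg_pair _ _ _ _ (nbhs _) (nbhs _)); first exact: cvg_cst.
    apply: cvgD; first exact: cvg_cst.
    by apply: cvgM; [exact: clamp_continuous|exact: cvg_cst].
  have lift W : small W -> (forall u, s <= u <= s + e -> (orbit @` W) (F (p, u))) ->
      exists l : R -> X, [/\ continuous l, forall u, W (l u) & forall u, orbit (l u) = gam u].
    move=> sW WF; have /choice[l lP] u : exists x, W x /\ orbit x = gam u.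
      by have [x Wx xF] := WF _ (gam_itv u); exists x.
    exists l; split=> [u|u|u]; [|by have [] := lP u|by have [] := lP u].
    by apply: (local_lift_continuous (b := gam) sW); [exact: cgam|exact: filterE].
  have [l [cl lU lF]] := lift U sU UF; have [l' [cl' lU' lF']] := lift U' sU' UF'.
  have ll' : l =1 l'.
    apply: (@orbit_lift_unique R l l' 0) => //; first exact: connected_line.
      by move=> u /=; rewrite lF lF'.
    have g0 : gam 0 = orbit (a p) by rewrite /gam clamp0 mul0r addr0 aF.
    by rewrite (small_inj sU (lU 0) Ua) ?lF ?g0// (small_inj sU' (lU' 0) Ua') ?lF' ?g0.
  have g1 : gam 1 = F (p, s + e) by rewrite /gam clamp1 mul1r.
  rewrite (small_inj sU Uy (lU 1)) ?yF ?lF// ll'.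
  by rewrite (small_inj sU' Uy' (lU' 1)) ?yF' ?lF'.
have /choice[c cP] p : exists y, exists U, good p U y.
  have [V [U [Vp sU Ua VU]]] := local p.
  by have [y gy] := good_ex p V U sU Ua (nbhs_singleton Vp) VU; exists y, U.
exists c => [p|p]; last by have [U []] := cP p.
have [V [U [Vp sU Ua VU]]] := local p.
apply: (local_lift_continuous (b := fun q => F (q, s + e)) sU).
  apply: (@continuous_comp _ _ _ (fun q => (q, s + e)) F); last exact: F_continuous.
  by apply: (@cvg_pair _ _ _ _ (nbhs _) (nbhs _)); [exact: cvg_id|exact: cvg_cst].
have nU : \forall q \near p, U (a q).
  by apply: ca; apply: open_nbhs_nbhs; split=> //; case: sU.
apply: filterS2 (nU) (Vp) => q Uq Vq; have [y gy] := good_ex q V U sU Uq Vq VU.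
have [U' gc] := cP q; rewrite (good_unique _ _ _ _ _ gc gy).
by case: gy.
Qed.

End Lift.

Lemma orbit_homotopy_lift (T : topologicalType) (F : T * R -> orbit_space X) (a : T -> X) :
  compact [set: T] -> continuous F -> continuous a -> (forall p, orbit (a p) = F (p, 0)) ->
  exists2 c : T -> X, continuous c & forall p, orbit (c p) = F (p, 1).
Proof.
move=> cT cF ca aF; have [e /= e0 eE] := evenly_near cT cF.
have [k] := ltr_add_invr e0; rewrite add0r => ke.
have k0 : 0 < k.+1%:R^-1 :> R by rewrite invr_gt0 ltr0Sn.
suff [c cc cF1] : exists2 c : T -> X, continuous c & forall p, orbit (c p) = F (p, k.+1%:R / k.+1%:R).
  by exists c => // p; rewrite cF1 divff ?pnatr_eq0.
have : (k.+1 <= k.+1)%N by [].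
(* Induction on the numerator alone; the denominator and the upper bound stay [k.+1]. *)
elim: {1 3}k.+1 => [_|j IHj jk]; first by exists a => // p; rewrite mul0r.
have [c cc cj] := IHj (ltnW jk).
have [|c' cc' c'j] := @lift_step T F cF (k.+1%:R^-1) (j%:R / k.+1%:R) (ltW k0) _ c cc cj.
  move=> p; apply: eE => //=.
    by rewrite distrC subr0 ger0_norm// ltW.
  by rewrite divr_ge0// ler_pdivrMr// mul1r ler_nat ltnW.
by exists c' => // p; rewrite c'j -[j.+1%:R]natr1 mulrDl mul1r.
Qed.

End OrbitProjection.

Definition continuous_map (X Y : topologicalType) (f : X -> Y) (cf : continuous f) :
  continuousType X Y := HB.pack f (isContinuous.Build X Y f cf).

(** * Supports of chains, cones, and acyclicity of contractible sets *)

Section Subchains.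
Variables (R : realType) (X : topologicalType) (A : set X).

Lemma subchain_gen n (s : singular R X n) : range s `<=` A -> gen s \in subchain A.
Proof. by move=> sA; apply/asboolP => s'; rewrite freeg.domU1 inE => /eqP ->. Qed.

Lemma eq_additive_subchain (V : zmodType) n (f g : {additive chain R X n -> V}) (c : chain R X n) :
  (forall s : singular R X n, range s `<=` A -> f (gen s) = g (gen s)) -> c \in subchain A -> f c = g c.
Proof.
move=> fg /asboolP cA; rewrite (chain_sumE c) !raddf_sum big_seq [RHS]big_seq.
by apply: eq_bigr => s /cA sA; rewrite [LHS](raddfMz f) [RHS](raddfMz g) fg.
Qed.

Lemma additive_subchain (V : zmodType) (S : zmodClosed V) n (f : {additive chain R X n -> V}) (c : chain R X n) :
  (forall s : singular R X n, range s `<=` A -> f (gen s) \in S) -> c \in subchain A -> f c \in S.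
Proof.
move=> fS /asboolP cA; rewrite (chain_sumE c) raddf_sum big_seq; apply: rpred_sum => s /cA sA.
by rewrite [X in X \in _](raddfMz f) rpredMz// fS.
Qed.

End Subchains.

Section Cone.
Variables (R : realType) (X : topologicalType).
Implicit Types n : nat.

Lemma rest_subproof n (t : std_simplex R n.+1) : val t 0 0 != 1 ->
  (\row_j (val t 0 (lift ord0 j) / (1 - val t 0 0)) : 'rV[R]_n.+1) \in std_simplex R n.
Proof.
move=> t1; have t0 : 0 < 1 - val t 0 0 by rewrite subr_gt0 lt_neqAle t1 simplex_le1.
apply/mem_set; split=> [j|]; first by rewrite mxE divr_ge0 ?(ltW t0)// simplex_ge0.
under eq_bigr do rewrite mxE; rewrite -mulr_suml.
have := simplex_sum t; rewrite big_ord_recl => /eqP.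
by rewrite addrC eq_sym -subr_eq => /eqP <-; rewrite divff// gt_eqF.
Qed.

(* Radial projection away from vertex 0 onto the opposite face; arbitrary at that vertex. *)
Definition rest n (t : std_simplex R n.+1) : std_simplex R n :=
  if pselect (val t 0 0 != 1) is left t1 then
    exist _ (\row_j (val t 0 (lift ord0 j) / (1 - val t 0 0))) (rest_subproof t1)
  else vertex R n.

Lemma restE n (t : std_simplex R n.+1) j : val t 0 0 != 1 ->
  val (rest t) 0 j = val t 0 (lift ord0 j) / (1 - val t 0 0).
Proof. by move=> t1; rewrite /rest; case: pselect => //= ?; rewrite mxE. Qed.

Lemma rest_continuous n (t : std_simplex R n.+1) : val t 0 0 != 1 -> {for t, continuous (@rest n)}.
Proof.
move=> t1; apply: continuous_simplex => j.
pose f (u : std_simplex R n.+1) : R := val u 0 (lift ord0 j) / (1 - val u 0 0).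
have Ft : Filter (nbhs t) by exact: nbhs_filter.
have cf : f @ nbhs t --> f t.
  apply: cvgM; first exact: (@simplex_coord_continuous R n.+1 (lift ord0 j) t).
  apply: cvgV; first by rewrite subr_eq0 eq_sym.
  by apply: cvgB; [exact: cvg_cst|exact: (@simplex_coord_continuous R n.+1 0 t)].
suff cr : (fun u => val (rest u) 0 j) @ nbhs t --> val (rest t) 0 j by exact: cr.
rewrite (restE _ t1); apply: cvg_trans cf; apply: near_eq_cvg.
have : nbhs t [set u : std_simplex R n.+1 | val u 0 0 != 1].
  have o1 : open [set x : R | x != 1] by exact: open_neq.
  by apply: (@simplex_coord_continuous R n.+1 0 t [set x | x != 1]); exact: open_nbhs_nbhs.
by apply: filterS => u u1; rewrite restE.
Qed.

Section ConeMap.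
Variables (n : nat) (F : std_simplex R n * R -> X) (x0 : X).
Hypothesis F_continuous : continuous F.
Hypothesis F1 : forall p, F (p, 1) = x0.

Definition cone_fun (t : std_simplex R n.+1) : X := F (rest t, val t 0 0).

(** Only the apex is delicate, where [rest] need not be continuous: there [F (p, 1)] is constant,
    and compactness of the simplex makes [F (p, s)] approach it uniformly in [p]. *)
Lemma cone_continuous : continuous cone_fun.
Proof.
move=> t; have [t1|t1] := eqVneq (val t 0 0) 1; last first.
  apply: (@continuous_comp _ _ _ (fun t => (rest t, val t 0 0)) F); last exact: F_continuous.
  apply: (@cvg_pair _ _ _ (nbhs t) (nbhs _) (nbhs _) (nbhs_filter t)); first exact: (rest_continuous t1).
  exact: (@simplex_coord_continuous R n.+1 0 t).
move=> W; rewrite /cone_fun t1 F1 => Wx0.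
have near_p p : [set: std_simplex R n] p -> \forall q \near p & s \near (1 : R), W (F (q, s)).
  move=> _; have : nbhs (p, 1 : R) (F @^-1` W) by apply: F_continuous; rewrite F1.
  by move=> [[U V] /= [Up V1] UV]; exists (U, V) => // -[q s] /= [Uq Vs]; exact: (UV (q, s)).
have near_1 := proj1 (compact_near_coveringP _) (@simplex_compact R n) R (nbhs (1 : R))
  (fun s q => W (F (q, s))) (nbhs_filter (1 : R)) near_p.
have : nbhs t [set u : std_simplex R n.+1 | forall q, W (F (q, val u 0 0))].
  apply: (@simplex_coord_continuous R n.+1 0 t [set s | forall q, W (F (q, s))]); rewrite t1.
  by apply: filterS near_1 => s sW q; exact: sW.
by apply: filterS => u; exact.
Qed.

Definition cone : singular R X n.+1 := continuous_map cone_continuous.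

End ConeMap.

Lemma cone_face0 n (F : std_simplex R n * R -> X) p : cone_fun F (face ord0 p) = F (p, 0).
Proof.
have e0 : val (face ord0 p) 0 0 = 0 by exact: face_fun_id.
rewrite /cone_fun e0; congr (F (_, _)); apply/val_inj/rowP => j.
rewrite restE e0 ?subr0 ?divr1; first exact: face_fun_lift.
by rewrite eq_sym oner_eq0.
Qed.

(** Radial projection from vertex 0 commutes with the faces containing that vertex; at the apex both
    sides are [x0]. *)
Lemma cone_faceS n (F : std_simplex R n.+1 * R -> X) x0 (F1 : forall p, F (p, 1) = x0) i p :
  cone_fun F (face (lift ord0 i) p) = cone_fun (fun x => F (face i x.1, x.2)) p.
Proof.
have e0 : val (face (lift ord0 i) p) 0 0 = val p 0 0.
  have {1}-> : 0 = lift (lift ord0 i) 0 :> 'I_n.+3 by apply/val_inj.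
  exact: face_fun_lift.
rewrite /cone_fun e0 /=; have [->|p1] := eqVneq (val p 0 0) 1; first by rewrite !F1.
congr (F (_, _)); apply/val_inj/rowP => j; rewrite restE ?e0//.
have [k ->|->] := unliftP i j.
  rewrite [RHS]face_fun_lift restE//; congr (_ / _).
  have -> : lift ord0 (lift i k) = lift (lift ord0 i) (lift ord0 k).
    by apply/val_inj => /=; rewrite /bump; lia.
  exact: face_fun_lift.
by rewrite [LHS](_ : _ = 0) ?[RHS]face_fun_id// [X in X / _](_ : _ = 0) ?mul0r// [LHS]face_fun_id.
Qed.

Lemma cone_face1 (F : std_simplex R 0 * R -> X) x0 (F1 : forall p, F (p, 1) = x0) p :
  cone_fun F (face (lift ord0 ord0) p) = x0.
Proof.
rewrite /cone_fun; have -> : val (face (lift ord0 ord0) p) 0 0 = 1; last exact: F1.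
have {1}-> : 0 = lift (lift ord0 ord0) 0 :> 'I_2 by apply/val_inj.
rewrite [LHS]face_fun_lift -(simplex_sum p) big_ord_recl big_ord0 addr0.
by congr (val p _ _); apply/val_inj.
Qed.

End Cone.

Section Contractible.
Variables (R : realType) (X : topologicalType) (A : set X) (x0 : X) (h : X * R -> X).
Hypothesis h_continuous : {within A `*` `[0, 1], continuous h}.
Hypothesis h_A : h @` (A `*` `[0, 1]) `<=` A.
Hypothesis h0 : forall x, A x -> h (x, 0) = x.
Hypothesis h1 : forall x, A x -> h (x, 1) = x0.

Lemma clamp_set (s : R) : `[0, 1]%classic (clamp s).
Proof. by rewrite /= in_itv; exact: clamp_itv. Qed.

Section Contraction.
Variables (n : nat) (s : singular R X n).
Hypothesis sA : range s `<=` A.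

Definition contraction (x : std_simplex R n * R) : X := h (s x.1, clamp x.2).

Lemma contraction_set (x : std_simplex R n * R) : (A `*` `[0, 1]%classic : set (X * R)) (s x.1, clamp x.2).
Proof. by split=> /=; [apply: sA; exists x.1|exact: clamp_set]. Qed.

Lemma contraction_continuous : continuous contraction.
Proof.
move=> x W; rewrite /contraction => Wx.
have cx : (fun x => (s x.1, clamp x.2)) @ nbhs x --> (s x.1, clamp x.2).
  apply: (@cvg_pair _ _ _ (nbhs x) (nbhs _) (nbhs _) (nbhs_filter x)).
    by apply: (@continuous_comp _ _ _ fst s); [exact: cvg_fst|exact: cts_fun].
  by apply: (@continuous_comp _ _ _ snd (@clamp R)); [exact: cvg_snd|exact: clamp_continuous].
have /subspace_continuousP/(_ _ (contraction_set x))/(_ W Wx) := h_continuous.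
by move=> /cx cW; apply: (@filterS _ _ (nbhs_filter x) _ _ _ cW) => y; apply; exact: contraction_set.
Qed.

Lemma contraction0 p : contraction (p, 0) = s p.
Proof. by rewrite /contraction /= clamp0 h0//; apply: sA; exists p. Qed.

Lemma contraction1 p : contraction (p, 1) = x0.
Proof. by rewrite /contraction /= clamp1 h1//; apply: sA; exists p. Qed.

Definition cone_simplex : singular R X n.+1 := cone contraction_continuous contraction1.

Lemma cone_simplex_sub : range cone_simplex `<=` A.
Proof.
move=> _ [t _ <-]; apply: h_A; exists (s (rest t), clamp (val t 0 0)) => //.
exact: (contraction_set (rest t, _)).
Qed.

End Contraction.

(** The chain homotopy given by the contraction. The value 0 on simplices outside [A] only makes it
    total; the identities below concern chains in [A]. *)
Definition cone_chain n : chain R X n -> chain R X n.+1 :=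
  lift_chain (fun s : singular R X n =>
    if pselect (range s `<=` A) is left sA then gen (cone_simplex sA) else 0).
Arguments cone_chain : simpl never.
HB.instance Definition _ n := GRing.isZmodMorphism.Build _ _ (@cone_chain n)
  (@lift_chain_is_zmod_morphism R X _ n _).

Lemma cone_chain_gen n (s : singular R X n) (sA : range s `<=` A) :
  cone_chain (gen s) = gen (cone_simplex sA).
Proof.
rewrite /cone_chain lift_chain_gen; case: pselect => // sA'.
by congr gen; apply/continuousEP.
Qed.

Lemma cone_chain_sub n (c : chain R X n) : c \in subchain A -> cone_chain c \in subchain A.
Proof.
apply: (@additive_subchain _ _ _ _ (@subchain R X A n.+1) n (@cone_chain n)) => s sA /=.
rewrite (cone_chain_gen sA); apply: subchain_gen.
exact: cone_simplex_sub.
Qed.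

Lemma sface_sub n (s : singular R X n.+1) i : range s `<=` A -> range (sface i s) `<=` A.
Proof. by move=> sA _ [t _ <-]; apply: sA; exists (face i t). Qed.

(** Face 0 of a cone is its base, and the other faces are cones over the faces of the base, with the
    sign shifted by one. *)
Lemma boundary_cone n (c : chain R X n.+1) : c \in subchain A ->
  boundary (cone_chain c) = c - cone_chain (boundary c).
Proof.
apply: (@eq_additive_subchain _ _ _ _ _ (@boundary R X n.+2 \o @cone_chain n.+1)
  (idfun \- (@cone_chain n \o @boundary R X n.+1))) => s sA /=.
rewrite cone_chain_gen !boundary_gen big_ord_recl raddf_sum /= expr0 scale1r.
apply: (congr2 (fun a b : chain R X n.+1 => a + b)).
  congr gen; apply/continuousEP => p; rewrite /= [LHS]cone_face0; exact: contraction0.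
rewrite -sumrN; apply: eq_bigr => i _.
rewrite raddfZsign /= (cone_chain_gen (sface_sub (i := i) sA)) exprS mulN1r scaleNr.
congr (- (_ *: gen _)); apply/continuousEP => p.
exact: (cone_faceS (contraction1 sA)).
Qed.

Definition point_simplex n : singular R X n := continuous_map (@cst_continuous _ _ x0).

Lemma boundary_cone0 (c : chain R X 0) : c \in subchain A ->
  boundary (cone_chain c) = c - gen (point_simplex 0) *~ degree c.
Proof.
have mulrz_is_additive : zmod_morphism (fun z : int => gen (point_simplex 0) *~ z).
  by move=> y z; rewrite mulrzBr.
pose f : {additive int -> chain R X 0} :=
  HB.pack (fun z : int => gen (point_simplex 0) *~ z) (GRing.isZmodMorphism.Build _ _ _ mulrz_is_additive).
apply: (@eq_additive_subchain _ _ _ _ _ (@boundary R X 1 \o @cone_chain 0)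
  (idfun \- (f \o @degree R X))) => s sA /=.
rewrite cone_chain_gen boundary_gen degree_gen !big_ord_recl big_ord0 addr0 expr0 scale1r.
rewrite lift0 expr1 scaleN1r; congr (gen _ - gen _); apply/continuousEP => p.
  by rewrite /= [LHS]cone_face0; exact: contraction0.
exact: (cone_face1 (contraction1 sA)).
Qed.

Lemma cone_exact n (c : chain R X n) : c \in subchain A -> aug_d (R := R) n c = 0 ->
  exists2 y, y \in subchain A & c = boundary (y : chain R X n.+1).
Proof.
case: n c => [|n] c cA /= c0; exists (cone_chain c); rewrite ?cone_chain_sub//.
  by rewrite boundary_cone0// c0 mulr0z subr0.
by rewrite boundary_cone// c0 raddf0 subr0.
Qed.

End Contractible.

Section ContractibleExact.
Variables (R : realType) (X : topologicalType) (A : set X).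
Hypothesis A_contractible : contractible R A.

Lemma contractible_exact n (c : aug R X n.+1) : c \in @subchain R X A n -> aug_d n c = 0 ->
  exists2 y : aug R X n.+2, y \in @subchain R X A n.+1 & c = aug_d n.+1 y.
Proof.
case: A_contractible => x0 Ax0 [h [ch hA h0 h1]] cA c0.
have [y yA cE] := cone_exact ch hA h0 h1 cA c0.
by exists y.
Qed.

Lemma contractible_point : exists2 e : aug R X 1, e \in @subchain R X A 0 & aug_d 0 e = 1.
Proof.
case: A_contractible => x0 Ax0 _; exists (gen (point_simplex R x0 0)); last exact: degree_gen.
by apply: subchain_gen => _ [t _ <-].
Qed.

End ContractibleExact.

(** * Lifting simplices and chains from orbit spaces *)

Lemma chain_lift (R : realType) (X Y : topologicalType) (q : continuousType X Y) (A : set Y) n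
    (c : chain R Y n) :
  (forall s : singular R Y n, range s `<=` A -> exists s' : singular R X n, q \o s' =1 s) ->
  c \in subchain A -> exists c', chain_map q c' = c.
Proof.
move=> lift /asboolP cA; rewrite (chain_sumE c).
have : {subset freeg.dom c <= [pred s : singular R Y n | `[< range s `<=` A >]]}.
  by move=> s /cA sA; apply/asboolP.
elim: (freeg.dom c) => [|s r IHr] sA; first by exists 0; rewrite raddf0 big_nil.
have [|c' c'E] := IHr; first by move=> s' s'r; apply: sA; rewrite inE s'r orbT.
have /asboolP/lift[s' s'E] := sA s (mem_head _ _).
exists (gen s' *~ freeg.coeff s c + c'); rewrite big_cons raddfD raddfMz /= c'E chain_map_gen.
by congr (gen _ *~ _ + _); apply/continuousEP.
Qed.

Section OrbitSimplices.
Variables (R : realType) (gT : finGroupType) (G : {group gT}) (X : gspace G).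
Hypothesis X_hausdorff : hausdorff_space X.
Hypothesis X_free : forall g (x : X), g \in G -> gact g x = x -> g = 1%g.

Definition orbit_cts : continuousType X (orbit_space X) :=
  continuous_map (@quot_proj_continuous X (@orbit_rel gT G X)).

(** The segments from vertex 0 form a homotopy from a constant map, which lifts at once, to [s]. *)
Lemma orbit_simplex_lift n (s : singular R (orbit_space X) n) :
  exists s' : singular R X n, orbit_cts \o s' =1 s.
Proof.
have [x xE] := quot_proj_surj (s (vertex R n)).
have [||||c cc cE] := @orbit_homotopy_lift _ _ X X_hausdorff X_free R (std_simplex R n)
  (fun y => s (segment y.1 y.2)) (fun=> x).
- exact: simplex_compact.
- move=> y; apply: (@continuous_comp _ _ _ (fun y : std_simplex R n * R => segment y.1 y.2) s).
    exact: segment_continuous.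
  exact: cts_fun.
- exact: cst_continuous.
- by move=> p; rewrite segment0 xE.
by exists (continuous_map cc) => p /=; rewrite [LHS]cE segment1.
Qed.

(** One [g] matches the two simplices at vertex 0, and uniqueness of lifts along the segments
    spreads it to every point. *)
Lemma orbit_simplex_fibre n (s s' : singular R X n) : orbit_cts \o s =1 orbit_cts \o s' ->
  exists2 g, g \in G & forall p, s' p = gact g (s p).
Proof.
move=> ss'; have [g Gg gE] := orbit_proj_rel (ss' (vertex R n)); exists g => // p.
have cseg (u : R) : {for u, continuous (fun u => segment p u)}.
  apply: (@continuous_comp _ _ _ (fun u => (p, u)) (fun y => segment y.1 y.2)).
    by apply: (@cvg_pair _ _ _ _ (nbhs _) (nbhs _)); [exact: cvg_cst|exact: cvg_id].
  exact: segment_continuous.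
have := @orbit_lift_unique _ _ _ X_hausdorff X_free R (fun u => gact g (s (segment p u)))
  (fun u => s' (segment p u)) 0 (@connected_line R).
move=> uniq; rewrite -[p]segment1; apply/esym; apply: uniq; last by rewrite segment0 gE.
- move=> u; apply: (@continuous_comp _ _ _ (fun u => s (segment p u))); last exact: gact_cts.
  by apply: continuous_comp; [exact: cseg|exact: cts_fun].
- by move=> u; apply: continuous_comp; [exact: cseg|exact: cts_fun].
by move=> u /=; rewrite orbit_proj_gact//; exact: ss'.
Qed.

End OrbitSimplices.

(** * A group element acting on augmented chains *)

Section CyclicAction.
Variables (R : realType) (gT : finGroupType) (G : {group gT}) (t : gT).
Hypothesis tG : t \in G.
Variable X : gspace G.

Definition gact_map : continuousType X X := continuous_map (gact_cts tG).

Definition aug_op (b : bool) k : {additive aug R X k -> aug R X k} :=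
  cyclic_op (aug_map gact_map k) #[t]%g b.

Lemma iter_gact k (x : X) : iter k gact_map x = gact (t ^+ k)%g x.
Proof.
elim: k x => [|k IHk] x; first by rewrite expg0 gact1.
by rewrite iterS IHk expgS gactM ?groupX.
Qed.

Lemma iter_gact_simplex k n (s : singular R X n) p :
  (iter k (fun s : singular R X n => gact_map \o s : singular R X n) s) p = gact (t ^+ k)%g (s p).
Proof. by rewrite -iter_gact; elim: k => //= k ->. Qed.

Lemma aug_d_op b n x : aug_d n (aug_op b n.+1 x) = aug_op b n (aug_d n x).
Proof. by apply: cyclic_op_morph => y; exact: aug_d_map. Qed.

Lemma aug_map_iter k n (c : aug R X n) : iter k (aug_map gact_map n) c =
  aug_map (continuous_map (gact_cts (groupX k tG)) : continuousType X X) n c.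
Proof.
elim: k => [|k IHk]; first by rewrite /= aug_map_id// => x; exact: gact1.
rewrite iterS IHk aug_map_comp; apply: eq_aug_map => x /=.
by rewrite expgS gactM ?groupX.
Qed.

Lemma aug_map_order n (c : aug R X n) : iter #[t]%g (aug_map gact_map n) c = c.
Proof. by rewrite aug_map_iter aug_map_id// => x /=; rewrite expg_order gact1. Qed.

Lemma aug_opK b n c : aug_op b n (aug_op (~~ b) n c) = 0.
Proof. by apply: cyclic_opK; exact: aug_map_order. Qed.

Lemma aug_op_diff0 (a : aug R X 0) : aug_op true 0 a = 0.
Proof. exact: subrr. Qed.

Lemma aug_op_sum0 (a : aug R X 0) : aug_op false 0 a = a *+ #[t]%g.
Proof.
rewrite /aug_op /= /orbit_sum -[in RHS](card_ord #[t]%g) -sumr_const.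
by apply: eq_bigr => j _; elim: (val j).
Qed.

Section FreeAction.
Hypothesis G_cycle : G = <[t]>%g :> {set gT}.
Hypothesis X_free : forall g (x : X), g \in G -> gact g x = x -> g = 1%g.
Variables (Y : topologicalType) (q : continuousType X Y).
Hypothesis q_inv : forall x, q (gact t x) = q x.
Hypothesis q_fibre : forall n (s s' : singular R X n), q \o s =1 q \o s' ->
  exists2 g, g \in G & forall p, s' p = gact g (s p).

Let order x : iter #[t]%g gact_map x = x.
Proof. by rewrite iter_gact expg_order gact1. Qed.

Let free n (s : singular R X n) k : (k < #[t]%g)%N ->
  iter k (fun s : singular R X n => gact_map \o s : singular R X n) s = s -> k = 0%N.
Proof.
move=> kt /continuousEP/(_ (vertex R n)); rewrite iter_gact_simplex => /X_free.
move=> /(_ (groupX _ tG))/eqP; rewrite -order_dvdn => tk.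
by apply/eqP; apply: contraLR kt; rewrite -lt0n -leqNgt => k0; exact: dvdn_leq.
Qed.

Let fibre n (s s' : singular R X n) : q \o s =1 q \o s' -> exists2 k, (k < #[t]%g)%N &
  s' = iter k (fun s : singular R X n => gact_map \o s : singular R X n) s.
Proof.
move=> /q_fibre[g]; rewrite G_cycle => /cyclePmin[k kt ->] gE; exists k => //.
by apply/continuousEP => p; rewrite iter_gact_simplex gE.
Qed.

(** The map [q] is a parameter because this serves both for [EG -> EG/G] and, over the subgroup, for
    the composite [EH -> EG/G]. *)
Lemma aug_op_exact b n (x : aug R X n.+1) : aug_op b n.+1 x = 0 ->
  exists y, x = aug_op (~~ b) n.+1 y.
Proof.
case: b; first exact: (@orbit_sum_exact R X Y n #[t]%g gact_map q q_inv order (@free n) (@fibre n) x).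
exact: (@orbit_diff_exact R X Y n #[t]%g gact_map q q_inv order (@free n) (@fibre n) x).
Qed.

(** Identifies the coinvariants with their image in the chains of [Y]. *)
Lemma aug_map_kernel n (x : aug R X n.+1) : aug_map q n.+1 x = 0 ->
  exists y, x = aug_op true n.+1 y.
Proof. exact: (@orbit_diff_kernel R X Y n #[t]%g gact_map q (@fibre n) x). Qed.

End FreeAction.
End CyclicAction.
Arguments aug_op {R gT G t} tG {X} b k.

(** * The induced space and its image in an orbit space *)

Lemma quot_closed (X : topologicalType) (r : X -> X -> Prop) (D : set (quot_space r)) :
  closed (quot_proj r @^-1` D) -> closed D.
Proof. by move=> cD; rewrite -openC; exact: (closed_openC cD). Qed.

Section Induced.
Variables (gT : finGroupType) (H : {group gT}).
Local Notation G := [set: gT]%G.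
Variable X : gspace H.

Lemma induced_proj_rel (p q : product_gspace X) :
  quot_proj (@induced_rel gT H X) p = quot_proj (@induced_rel gT H X) q ->
  exists2 h, h \in H & p.1 = ((q.1 : gT) * h)%g :> gT /\ q.2 = gact h p.2.
Proof.
move=> /quot_proj_rel; elim=> {p q} [p q [h Hh [g [x [-> ->]]]]|p|p q _ [h Hh [pE qE]]|
  p q r _ [h Hh [pE qE]] _ [k Hk [qE' rE]]].
- by exists h.
- by exists 1%g; rewrite ?group1 ?mulg1 ?gact1.
- by exists h^-1%g; rewrite ?groupV// pE mulgK qE gactK.
- by exists (k * h)%g; rewrite ?groupM// pE qE' mulgA rE qE gactM.
Qed.

Definition induced_unit (x : X) : induced X :=
  quot_proj (@induced_rel gT H X) ((1%g : translation_space gT), x).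

Lemma induced_unit_continuous : continuous induced_unit.
Proof.
move=> x; apply: (@continuous_comp _ _ _ (fun x => ((1%g : translation_space gT), x))).
  by apply: (@cvg_pair _ _ _ _ (nbhs _) (nbhs _)); [exact: cvg_cst|exact: cvg_id].
exact: quot_proj_continuous.
Qed.

Lemma gact_induced_unit g x : gact g (induced_unit x) =
  quot_proj (@induced_rel gT H X) ((g : translation_space gT), x).
Proof.
rewrite /induced_unit -(quot_gprojJ (@induced_relJ gT H X)) ?inE//.
by rewrite /= /product_act /translation /= mulg1.
Qed.

Lemma induced_unitJ h x : h \in H -> induced_unit (gact h x) = gact h (induced_unit x).
Proof.
move=> Hh; rewrite gact_induced_unit; apply/esym/quot_proj_eq; exists h => //.
by exists 1%g, x; rewrite mul1g.
Qed.

Lemma induced_unit_rel g x x' : induced_unit x' = gact g (induced_unit x) ->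
  g \in H /\ x' = gact g x.
Proof.
rewrite gact_induced_unit => /esym/induced_proj_rel[h Hh /= []].
by rewrite mul1g => -> ->.
Qed.

Lemma induced_unit_surj (y : induced X) : exists g x, y = gact g (induced_unit x).
Proof.
have [[g x] ->] := quot_proj_surj y; exists g, x.
by rewrite gact_induced_unit.
Qed.

(** The preimage in [G * X] is the finite union, over [h] in [H], of the closed sets of pairs
    [(h, x)] with [h x] in [C]. *)
Lemma induced_unit_closed (C : set X) : closed C -> closed (induced_unit @` C).
Proof.
move=> cC; apply: quot_closed.
rewrite (_ : _ @^-1` _ = \bigcup_(h in [set h | h \in H])
    ((fst @^-1` [set (h : translation_space gT)]) `&` ((gact h : X -> X) \o snd) @^-1` C)).
  apply: closed_bigcup => [|h Hh]; first exact: finite_finset.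
  apply: closedI.
    apply: (proj1 (continuous_closedP _)); first by move=> ?; exact: cvg_fst.
    by rewrite -openC; exact: (@discrete_open (discrete_topology gT)).
  apply: (proj1 (continuous_closedP _)) => // y.
  by apply: continuous_comp; [exact: cvg_snd|exact: gact_cts].
apply/seteqP; split=> [[g x] [y Cy yE]|[g x] [h /= Hh [-> Chx]]].
  have [|Hg yx] := @induced_unit_rel g x y; first by rewrite gact_induced_unit.
  by exists g => //; split=> //=; rewrite -yx.
by exists (gact h x) => //; rewrite induced_unitJ// gact_induced_unit.
Qed.

Section Embedding.
Variables (Y : gspace G) (i : gmap (induced X) Y).
Hypothesis i_inj : injective i.
Hypothesis i_closed : forall C, closed C -> closed (i @` C).

Lemma induced_map_continuous : continuous (i \o induced_unit).
Proof.
by move=> x; apply: continuous_comp; [exact: induced_unit_continuous|exact: cts_fun].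
Qed.

Definition induced_map : continuousType X Y := continuous_map induced_map_continuous.

Lemma induced_mapJ h x : h \in H -> induced_map (gact h x) = gact h (induced_map x).
Proof. by move=> Hh; rewrite /= induced_unitJ// gfunJ ?inE. Qed.

Lemma induced_map_rel g x x' : induced_map x' = gact g (induced_map x) ->
  g \in H /\ x' = gact g x.
Proof. by rewrite /= -gfunJ ?inE// => /i_inj/induced_unit_rel. Qed.

Lemma induced_map_range y : range i y -> exists g x, y = gact g (induced_map x).
Proof.
by move=> [z _ <-]; have [g [x ->]] := induced_unit_surj z; exists g, x; rewrite gfunJ ?inE.
Qed.

Local Notation orbitX := (quot_proj (@orbit_rel gT H X)).
Local Notation orbitY := (quot_proj (@orbit_rel gT G Y)).

Lemma orbit_induced_map_inj x x' : orbitY (induced_map x) = orbitY (induced_map x') ->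
  exists2 h, h \in H & x' = gact h x.
Proof. by move=> /orbit_proj_rel[g _ /induced_map_rel[Hg ->]]; exists g. Qed.

Lemma orbit_induced_map_closed C : closed C -> closed ((orbitY \o induced_map) @` C).
Proof.
move=> cC; apply: quot_closed.
rewrite (_ : _ @^-1` _ = \bigcup_(g in [set: gT]) (gact g @^-1` (induced_map @` C))).
  apply: closed_bigcup => [|g _]; first exact: finite_finset.
  apply: (proj1 (continuous_closedP _)); first by apply: gact_cts; rewrite inE.
  have -> : induced_map @` C = i @` (induced_unit @` C) by rewrite image_comp.
  exact/i_closed/induced_unit_closed.
apply/seteqP; split=> [y [x Cx /orbit_proj_rel[g _ yE]]|y [g _ [x Cx xE]]].
  exists g^-1%g => //; exists x => //; rewrite yE gactK ?inE//.
by exists x => //=; rewrite [i _]xE; apply: orbit_proj_gact; rewrite inE.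
Qed.

Hypothesis X_hausdorff : hausdorff_space X.
Hypothesis X_free : forall g (x : X), g \in H -> gact g x = x -> g = 1%g.

(** Pointwise preimages are unique up to [H], so they define a map to [X/H]. It is continuous
    because [X -> Y/G] is closed, and it lifts to [X] by covering theory. *)
Lemma induced_simplex_lift (R : realType) n (s : singular R (orbit_space Y) n) :
  range s `<=` orbitY @` range i ->
  exists s' : singular R X n, (orbit_cts Y \o induced_map : continuousType _ _) \o s' =1 s.
Proof.
move=> sA; have /choice[x xE] p : exists x, orbitY (induced_map x) = s p.
  have [|y /induced_map_range[g [x ->]] <-] := sA (s p); first by exists p.
  by exists x; rewrite orbit_proj_gact ?inE.
have cs : continuous (orbitX \o x).
  apply/continuous_closedP => D cD.
  rewrite (_ : _ @^-1` D = s @^-1` ((orbitY \o induced_map) @` (orbitX @^-1` D))).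
    apply: (proj1 (continuous_closedP _)); first exact: cts_fun.
    apply: orbit_induced_map_closed.
    by apply: (proj1 (continuous_closedP _)) cD; exact: quot_proj_continuous.
  apply/seteqP; split=> [p Dp|p [y Dy /=]]; first by exists (x p) => //; exact: xE.
  rewrite -xE => /orbit_induced_map_inj[h Hh xpE].
  by rewrite /= xpE orbit_proj_gact.
have [s' s'E] := orbit_simplex_lift X_hausdorff X_free (continuous_map cs).
exists s' => p; rewrite /= -xE.
have /orbit_proj_rel[h Hh ->] := s'E p.
by rewrite -[RHS]/(orbitY (induced_map _)) induced_mapJ// orbit_proj_gact ?inE.
Qed.

(** The fibre lemma in [Y] provides some [g] in [G], and injectivity of [i] forces it into [H]. *)
Lemma induced_simplex_fibre (R : realType) n (s s' : singular R X n) :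
  hausdorff_space Y -> (forall g (y : Y), g \in G -> gact g y = y -> g = 1%g) ->
  (orbit_cts Y \o induced_map : continuousType _ _) \o s =1 (orbit_cts Y \o induced_map : continuousType _ _) \o s' ->
  exists2 h, h \in H & forall p, s' p = gact h (s p).
Proof.
move=> Y_hausdorff Y_free ss'.
have [|g _ gE] := @orbit_simplex_fibre R _ _ Y Y_hausdorff Y_free n (induced_map \o s) (induced_map \o s').
  by move=> p; exact: ss'.
have [Hg _] := induced_map_rel (gE (vertex R n)); exists g => // p.
by have [] := induced_map_rel (gE p).
Qed.

End Embedding.
End Induced.

Lemma subchainT (R : realType) (X : topologicalType) n (c : chain R X n) : c \in subchain [set: X].
Proof. exact/asboolP. Qed.

Lemma aug_exact (R : realType) (X : topologicalType) : contractible R [set: X] ->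
  forall n (x : aug R X n.+1), aug_d n x = 0 -> exists y, x = aug_d n.+1 y.
Proof.
by move=> cX n x x0; have [y _ yE] := contractible_exact cX (subchainT x) x0; exists y.
Qed.

Lemma aug_surj (R : realType) (X : topologicalType) : contractible R [set: X] ->
  forall a : aug R X 0, exists x, aug_d 0 x = a.
Proof.
by move=> cX a; have [e _ eE] := contractible_point cX; exists (e *~ a); rewrite raddfMz eE intz.
Qed.

Lemma aug_op_map (R : realType) (gT : finGroupType) (G : {group gT}) t (tG : t \in G) (X Y : gspace G)
    (f : gmap X Y) b k (x : aug R X k) :
  aug_map f k (aug_op tG b k x) = aug_op tG b k (aug_map f k x).
Proof.
apply: cyclic_op_morph => y; rewrite !aug_map_comp; apply: eq_aug_map => z /=.
exact: gfunJ.
Qed.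

Lemma aug_map_orbit (R : realType) (gT : finGroupType) (G : {group gT}) t (tG : t \in G) (X : gspace G)
    k (x : aug R X k) : aug_map (orbit_cts X) k (aug_op tG true k x) = 0.
Proof.
rewrite /aug_op /= /orbit_diff raddfB aug_map_comp; apply/eqP; rewrite subr_eq0; apply/eqP.
by apply: eq_aug_map => z /=; exact: orbit_proj_gact.
Qed.

Lemma addr_middleK (V : zmodType) (a b c : V) : a + b + c - b = a + c.
Proof. by rewrite addrAC addrK. Qed.

Lemma addr_middle (V : zmodType) (a b c : V) : b = a + b + c - a - c.
Proof. by rewrite addrAC addrK addrC addKr. Qed.

(** * The inclusion of [C_2] in [C_4] *)

Section Chains.
Variables (R : realType) (gT : finGroupType) (H : {group gT}) (t : gT).
Local Notation G := [set: gT]%G.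
Hypothesis G_cycle : G = <[t]>%g :> {set gT}.
Hypothesis t_order : #[t]%g = 4%N.
Hypothesis H_cycle : H = <[t ^+ 2]>%g :> {set gT}.

Let tG : t \in G. Proof. by rewrite inE. Qed.
Let sH : (t ^+ 2)%g \in H. Proof. by rewrite H_cycle cycle_id. Qed.
Let s_order : #[t ^+ 2]%g = 2%N. Proof. by rewrite orderXdiv t_order. Qed.

(** The operator [1 + t], written as a [cyclic_op] of length 2 so that [cyclic_op_morph] applies
    although [t] has order 4. *)
Definition half_sum (X : gspace G) k : {additive aug R X k -> aug R X k} :=
  cyclic_op (aug_map (gact_map tG X) k) 2 false.

Section HalfSum.
Variable X : gspace G.
Local Notation act := (aug_map (gact_map tG X) _).

Lemma half_sumE k x : half_sum X k x = x + act x.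
Proof. by rewrite /half_sum /= /orbit_sum !big_ord_recl big_ord0 addr0. Qed.

Lemma aug_sumE k x : aug_op tG false k x = x + act x + act (act x) + act (act (act x)) :> aug R X k.
Proof. by rewrite /aug_op t_order /= /orbit_sum !big_ord_recl big_ord0 addr0 !addrA. Qed.

Lemma aug_d_half_sum n x : aug_d n (half_sum X n.+1 x) = half_sum X n (aug_d n x).
Proof. by apply: cyclic_op_morph => y; exact: aug_d_map. Qed.

Lemma half_sum0 a : half_sum X 0 a = a *+ 2.
Proof. by rewrite half_sumE mulr2n. Qed.

Lemma half_sumB k x : half_sum X k x - aug_op tG true k x = x *+ 2.
Proof. by rewrite half_sumE opprB addrACA subrr addr0 mulr2n. Qed.

End HalfSum.

Section Relative.
Variables (X : gspace H) (Y : gspace G) (i : gmap (induced X) Y).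
Hypothesis X_hausdorff : hausdorff_space X.
Hypothesis X_free : forall g (x : X), g \in H -> gact g x = x -> g = 1%g.
Hypothesis X_contractible : contractible R [set: X].
Hypothesis Y_hausdorff : hausdorff_space Y.
Hypothesis Y_free : forall g (y : Y), g \in G -> gact g y = y -> g = 1%g.
Hypothesis Y_contractible : contractible R [set: Y].
Hypothesis i_inj : injective i.

Local Notation j := (@aug_map R X Y (induced_map i)).
Local Notation dX := (@aug_d R X).
Local Notation dY := (@aug_d R Y).
Local Notation TX := (@aug_op R gT H _ sH X).
Local Notation TY := (@aug_op R gT G _ tG Y).

Lemma aug_map_induced k (x : aug R X k) : j k (aug_map (gact_map sH X) k x) =
  aug_map (gact_map tG Y) k (aug_map (gact_map tG Y) k (j k x)).
Proof.
rewrite !aug_map_comp; apply: eq_aug_map => y /=.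
by rewrite induced_unitJ// gfunJ ?inE// expgS expg1 gactM ?inE.
Qed.

Lemma induced_diff k (x : aug R X k) : j k (TX true k x) = TY true k (half_sum Y k (j k x)).
Proof.
rewrite half_sumE /aug_op /= /orbit_diff raddfB aug_map_induced !raddfD /=.
by rewrite [- _ - _]addrC addrACA subrr add0r.
Qed.

Lemma induced_sum k (x : aug R X k) : half_sum Y k (j k (TX false k x)) = TY false k (j k x).
Proof.
rewrite half_sumE aug_sumE /aug_op s_order /= /orbit_sum !big_ord_recl big_ord0 addr0 /=.
by rewrite raddfD /= aug_map_induced raddfD /= !addrA; congr (_ + _); rewrite addrAC.
Qed.

Definition induced_orbit : continuousType X (orbit_space Y) := orbit_cts Y \o induced_map i.

Let induced_orbit_inv x : induced_orbit (gact (t ^+ 2)%g x) = induced_orbit x.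
Proof. by rewrite /= -[i _]/(induced_map i _) induced_mapJ// orbit_proj_gact ?inE. Qed.

Let induced_orbit_fibre n (s s' : singular R X n) : induced_orbit \o s =1 induced_orbit \o s' ->
  exists2 h, h \in H & forall p, s' p = gact h (s p).
Proof. exact: induced_simplex_fibre. Qed.

Let T_exactX b n (x : aug R X n.+1) : TX b n.+1 x = 0 -> exists y, x = TX (~~ b) n.+1 y.
Proof. exact: (aug_op_exact H_cycle X_free induced_orbit_inv induced_orbit_fibre). Qed.

Let T_kernelX n (x : aug R X n.+1) : aug_map induced_orbit n.+1 x = 0 ->
  exists y, x = TX true n.+1 y.
Proof. exact: (aug_map_kernel sH H_cycle induced_orbit_fibre). Qed.

Let orbit_inv (y : Y) : orbit_cts Y (gact t y) = orbit_cts Y y.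
Proof. exact: orbit_proj_gact. Qed.

Let orbit_fibre n (s s' : singular R Y n) : orbit_cts Y \o s =1 orbit_cts Y \o s' ->
  exists2 g, g \in G & forall p, s' p = gact g (s p).
Proof. exact: orbit_simplex_fibre. Qed.

Let T_exactY b n (x : aug R Y n.+1) : TY b n.+1 x = 0 -> exists y, x = TY (~~ b) n.+1 y.
Proof. exact: (aug_op_exact G_cycle Y_free orbit_inv orbit_fibre). Qed.

Lemma orbit_kernel n (x : aug R Y n.+1) : aug_map (orbit_cts Y) n.+1 x = 0 ->
  exists y, x = TY true n.+1 y.
Proof. exact: (aug_map_kernel tG G_cycle orbit_fibre). Qed.

(** The image of [dX b] in the orbit space of [Y] is 0, which starts a zigzag over [H]; it is then
    restricted to [Y]. At the augmentation [1 + t] is multiplication by 2, so the integer doubles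
    when the degree [m + 1] of [b] is odd. *)
Lemma relative_zigzag m (b : aug R X m.+2) y : dY m.+1 (j m.+2 b) = TY true m.+1 y ->
  exists be, zigzag dX TX true b be /\ zigzag dY TY true (j m.+2 b) (if odd m then be else be *+ 2).
Proof.
move=> db; have [|b1 bE] := @T_kernelX m (dX m.+1 b).
  by rewrite -aug_map_comp -aug_d_map db aug_map_orbit.
have [be zb] := zigzag_exists (@aug_dd R X) (@aug_d_op R _ _ _ sH X) T_exactX bE.
exists be; split=> //.
have := zigzag_restrict (@aug_d_map R _ _ (induced_map i)) (@aug_d_half_sum Y)
  induced_diff induced_sum zb.
by rewrite half_sum0 /= negbK.
Qed.

(** The class of [b] dies in the orbit space of [Y]. Its integer shows that [b] already bounds over
    [H], and subtracting the bounding chain from [x] leaves an absolute cycle of coinvariants. *)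
Lemma relative_absolute m (x : aug R Y m.+3) (b : aug R X m.+2) y :
  dY m.+2 x = j m.+2 b + TY true m.+2 y ->
  exists b' y', dY m.+2 (x - j m.+3 b') = TY true m.+2 y'.
Proof.
move=> dx; have [|be [zb zjb]] := @relative_zigzag m b (- dY m.+1 y).
  have -> : j m.+2 b = dY m.+2 x - TY true m.+2 y by rewrite dx addrK.
  by rewrite raddfB aug_dd sub0r aug_d_op raddfN.
have [be' beE] : exists be', be = TX (true (+) odd m.+1) 0 be'.
  rewrite /= negbK; case: (boolP (odd m)) zb zjb => om zb zjb.
    (* Even degree [m + 1]: the end constraint of the zigzag gives [2 be = 0]. *)
    exists 0; rewrite aug_op_diff0; have := zigzag_constraint (@aug_dd R X) (@aug_d_op R _ _ _ sH X) zb.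
    rewrite /= om aug_op_sum0 s_order => /eqP.
    by rewrite mulrn_eq0 => /eqP.
  (* Odd degree: [j b] is a boundary modulo [t - 1], so its integer [2 be] is a multiple [4 a], and
     [be = 2 a] lies in the image of the norm of [H]. *)
  have [a aE] : exists a, be *+ 2 = TY (true (+) odd m.+1) 0 a.
    apply: (zigzag_unique (@aug_dd R Y) (@aug_d_op R _ _ _ tG Y) T_exactY
      (w := x) (w' := - y)); rewrite dx raddfN addrK; exact: zjb.
  move: aE; rewrite /= (negbTE om) !aug_op_sum0 t_order => aE; exists a.
  rewrite (@aug_op_sum0 R gT H _ sH X a) s_order.
  by clear -aE; move: aE; rewrite /aug /= in be a *; lia.
have [w [w' bE]] := zigzag_vanish (@aug_d_op R _ _ _ sH X) (@aug_opK R _ _ _ sH X)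
  (aug_exact X_contractible) (aug_surj X_contractible) zb beE.
exists w, (y + half_sum Y m.+2 (j m.+2 w')).
rewrite raddfB dx aug_d_map bE [j _ (_ + _)]raddfD induced_diff [RHS]raddfD.
by rewrite addrAC [_ + TY _ _ (half_sum _ _ _)]addrC addrK addrC.
Qed.

(** The witness has zigzag integer 1; a decomposition of the excluded kind would give
    [1 - 2 be = 4 a]. *)
Lemma relative_nonzero m : odd m -> exists x : aug R Y m.+3,
  (exists y, dY m.+2 x = TY true m.+2 y) /\
  forall d (b : aug R X m.+3) y, x <> dY m.+3 d + j m.+3 b + TY true m.+3 y.
Proof.
move=> om; have [|x zx] := zigzag_construct (@aug_d_op R _ _ _ tG Y) (@aug_opK R _ _ _ tG Y)
  (aug_exact Y_contractible) (aug_surj Y_contractible) (b := true) (n := m.+2) (a := 1).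
  by rewrite /= negbK om aug_op_diff0.
have dx : exists y, dY m.+2 x = TY true m.+2 y by case: zx => y ->; exists y.
exists x; split=> // d b y xE; case: dx => y0 dx.
have [|be [_ zjb]] := @relative_zigzag m.+1 b (y0 - dY m.+2 y).
  have jE : j m.+3 b = x - dY m.+3 d - TY true m.+3 y.
    rewrite [in RHS]xE.
    exact: (@addr_middle (aug R Y m.+3) (dY m.+3 d) (j m.+3 b) (TY true m.+3 y)).
  rewrite jE.
  by rewrite (raddfB (dY m.+2)) (raddfB (dY m.+2)) dx aug_dd subr0 aug_d_op [RHS]raddfB.
have := zigzagB zx zjb.
have -> : x - j m.+3 b = dY m.+3 d + TY true m.+3 y.
  by rewrite xE; exact: (@addr_middleK (aug R Y m.+3) (dY m.+3 d) (j m.+3 b) (TY true m.+3 y)).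
move=> /(zigzag_unique (@aug_dd R Y) (@aug_d_op R _ _ _ tG Y) T_exactY)[a].
rewrite /= negbK om (@aug_op_sum0 R gT G _ tG Y a) t_order => aE.
by clear -aE; move: aE; rewrite /aug /= in be a *; lia.
Qed.

Hypothesis i_closed : forall C, closed C -> closed (i @` C).

Local Notation base := (quot_proj (@orbit_rel gT G Y) @` range i).

Lemma orbit_chain_lift n (z : chain R (orbit_space Y) n) :
  exists x : aug R Y n.+1, aug_map (orbit_cts Y) n.+1 x = z.
Proof.
apply: (@chain_lift R _ _ (orbit_cts Y) setT n z _ (subchainT z)) => s _.
exact: orbit_simplex_lift.
Qed.

Lemma base_chain_lift n (z : chain R (orbit_space Y) n) : z \in subchain base ->
  exists b : aug R X n.+1, aug_map (orbit_cts Y) n.+1 (j n.+1 b) = z.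
Proof.
move=> zB; have [|b bE] := @chain_lift R _ _ induced_orbit base n z _ zB.
  by move=> s sB; exact: induced_simplex_lift.
by exists b; rewrite aug_map_comp.
Qed.

Lemma relative_chain_nonzero m : odd m -> exists2 z : chain R (orbit_space Y) m.+2,
  boundary z = 0 & forall d, z - boundary (d : chain R (orbit_space Y) m.+3) \notin subchain base.
Proof.
move=> om; have [x [[y dx] xN]] := relative_nonzero om.
exists (aug_map (orbit_cts Y) m.+3 x).
  by rewrite -[LHS]/(aug_d m.+2 _) aug_d_map dx aug_map_orbit.
move=> d; apply/negP => /base_chain_lift[b bE]; have [d' d'E] := orbit_chain_lift d.
have [|y' y'E] := @orbit_kernel m.+2 (x - (dY m.+3 d' + j m.+3 b)).
  rewrite raddfB raddfD bE -aug_d_map d'E -[aug_d _ _]/(boundary d).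
  by rewrite [boundary d + _]addrC subrK subrr.
by apply: (xN d' b y'); rewrite -y'E addrC subrK.
Qed.

(** * Vanishing in the space with contractible fixed points *)

Section Comparison.
Variables (Z : gspace G) (g : gmap Y Z).
Hypothesis Z_contractible : contractible R [set: Z].
Hypothesis Z_fixed_contractible : contractible R (@fixed_points _ _ Z H).

Local Notation dZ := (@aug_d R Z).
Local Notation TZ := (@aug_op R gT G _ tG Z).
Local Notation act := (aug_map (gact_map tG Z)).

Let fixed n (x : aug R Z n.+1) : Prop := x \in @subchain R Z (@fixed_points _ _ Z H) n.

Let fixedD n (x y : aug R Z n.+1) : fixed x -> fixed y -> fixed (x + y).
Proof. exact: rpredD. Qed.

Let fixedB n (x y : aug R Z n.+1) : fixed x -> fixed y -> fixed (x - y).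
Proof. exact: rpredB. Qed.

(** The group is abelian, so [t] preserves the [H]-fixed points. *)
Let fixed_act n (x : aug R Z n.+1) : fixed x -> fixed (act n.+1 x).
Proof.
apply: (@additive_subchain _ _ _ _ _ n (aug_map (gact_map tG Z) n.+1)) => s sF.
rewrite /= chain_map_gen; apply: subchain_gen => _ [p _ <-] h Hh /=.
have th : commute t h.
  by apply: (centsP (cycle_abelian t)); rewrite ?cycle_id// -G_cycle inE.
rewrite -gactM ?inE// -th gactM ?inE//; congr gact; apply: sF Hh.
by exists p.
Qed.

Let fixed_act2 n (x : aug R Z n.+1) : fixed x -> act n.+1 (act n.+1 x) = x.
Proof.
move=> Fx; rewrite aug_map_comp; move: Fx.
apply: (@eq_additive_subchain _ _ _ _ n (aug_map _ n.+1) idfun) => s sF /=.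
rewrite chain_map_gen; congr gen; apply/continuousEP => p /=.
rewrite -gactM ?inE//; apply: (sF (s p)); last exact: sH.
by exists p.
Qed.

Let fixed_diff n (x : aug R Z n.+1) : fixed x -> fixed (TZ true n.+1 x).
Proof. by move=> Fx; apply: fixedB => //; exact: fixed_act. Qed.

Let fixed_half n (x : aug R Z n.+1) : fixed x -> fixed (half_sum Z n.+1 x).
Proof. by move=> Fx; rewrite half_sumE; apply: fixedD => //; exact: fixed_act. Qed.

Let diff_half n (x : aug R Z n.+1) : fixed x -> TZ true n.+1 (half_sum Z n.+1 x) = 0.
Proof.
move=> Fx; rewrite half_sumE [TZ _ _ _]/(_ - _) (raddfD (act n.+1)) fixed_act2//.
by apply/eqP; rewrite subr_eq0 addrC.
Qed.

Let half_diff n (x : aug R Z n.+1) : fixed x -> half_sum Z n.+1 (TZ true n.+1 x) = 0.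
Proof.
move=> Fx; rewrite half_sumE [TZ _ _ _]/(_ - _) (raddfB (act n.+1)) fixed_act2//.
by rewrite addrA subrK subrr.
Qed.

Let sum_half n (x : aug R Z n.+1) : fixed x -> TZ false n.+1 x = half_sum Z n.+1 x *+ 2.
Proof. by move=> Fx; rewrite aug_sumE half_sumE fixed_act2// mulr2n addrA. Qed.

Let fixed_exact n (x : aug R Z n.+1) : fixed x -> dZ n x = 0 ->
  exists2 y, @fixed n.+1 y & x = dZ n.+1 y.
Proof. exact: contractible_exact. Qed.

Let fixed_point (a : aug R Z 0) : exists e (c : int),
  [/\ @fixed 0 e, dZ 0 (TZ true 1 e) = 0 & dZ 0 e *~ c = a].
Proof.
have [e Fe e1] := contractible_point Z_fixed_contractible.
by exists e, a; rewrite aug_d_op aug_op_diff0 e1 intz.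
Qed.

(** For even [m] the integer satisfies [4 a = 0], so the cycle bounds already in the coinvariants of
    [Y]. For odd [m] it is pushed into the fixed chains of [Z]. *)
Lemma comparison_vanish m (x : aug R Y m.+3) y : dY m.+2 x = TY true m.+2 y ->
  exists w w', aug_map g m.+3 x = dZ m.+3 w + TZ true m.+3 w'.
Proof.
move=> dx; have [a zx] := zigzag_exists (@aug_dd R Y) (@aug_d_op R _ _ _ tG Y) T_exactY dx.
case: (boolP (odd m)) => om; last first.
  have := zigzag_constraint (@aug_dd R Y) (@aug_d_op R _ _ _ tG Y) zx.
  rewrite /= negbK (negbTE om) (@aug_op_sum0 R gT G _ tG Y a) t_order => /eqP.
  rewrite mulrn_eq0 => /eqP a0.
  have [|w [w' ->]] := zigzag_vanish (@aug_d_op R _ _ _ tG Y) (@aug_opK R _ _ _ tG Y)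
    (aug_exact Y_contractible) (aug_surj Y_contractible) (a' := 0) zx.
    by rewrite a0 raddf0.
  exists (aug_map g m.+4 w), (aug_map g m.+3 w').
  by rewrite (raddfD (aug_map g m.+3)) aug_op_map -aug_d_map.
by apply: (zigzag_comparison_vanish (@aug_d_map R Y Z g) _ (@aug_d_op R _ _ _ tG Z)
  (@aug_opK R _ _ _ tG Z) (aug_exact Z_contractible) (@aug_d_half_sum Z) (@half_sumB Z)
  fixed_half fixed_diff diff_half half_diff sum_half fixed_exact fixed_point _ _ zx) => [b n z|//|];
  [exact: aug_op_map|rewrite /= negbK].
Qed.

Variables (gG : continuousType (orbit_space Y) (orbit_space Z)) (e : Z).
Hypothesis gG_orbit : forall y, gG (orbit_cts Y y) = orbit_cts Z (g y).
Hypothesis g_induced : forall x, g (induced_map i x) = e.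

(** A lift of [z] is an absolute cycle up to a chain coming from [X]. The absolute part dies by
    [comparison_vanish], and [g] sends the correction to the point [e]. *)
Lemma relative_chain_vanish m (z : chain R (orbit_space Y) m.+2) : boundary z \in subchain base ->
  exists (w : chain R (orbit_space Z) m.+3) (c : chain R (orbit_space Z) m.+2),
    c \in subchain [set orbit_cts Z e] /\ chain_map gG z = boundary w + c.
Proof.
move=> /base_chain_lift[b bE]; have [x xE] := orbit_chain_lift z.
have [|y yE] := @orbit_kernel m.+1 (dY m.+2 x - j m.+2 b).
  by rewrite raddfB bE -aug_d_map xE subrr.
have [|b' [y' dx]] := @relative_absolute m x b y; first by rewrite -yE addrC subrK.
have [w [w' gx]] := comparison_vanish dx.
exists (aug_map (orbit_cts Z) m.+4 w), (aug_map (orbit_cts Z) m.+3 (aug_map g m.+3 (j m.+3 b'))).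
split.
  rewrite !aug_map_comp.
  apply: (@additive_subchain _ _ _ _ _ _ (aug_map _ m.+3) _ _ (subchainT b')) => s _.
  rewrite /= chain_map_gen; apply: subchain_gen => _ [p _ <-] /=.
  by rewrite [g _]g_induced.
rewrite -xE -[LHS]/(aug_map gG m.+3 (aug_map (orbit_cts Y) m.+3 x)).
have -> : aug_map gG m.+3 (aug_map (orbit_cts Y) m.+3 x) =
    aug_map (orbit_cts Z) m.+3 (aug_map g m.+3 x).
  by rewrite !aug_map_comp; apply: eq_aug_map => u; exact: gG_orbit.
rewrite -[in LHS](subrK (j m.+3 b') x) raddfD raddfD gx raddfD aug_map_orbit addr0.
by rewrite -aug_d_map.
Qed.

End Comparison.

End Relative.
End Chains.

(** * From chains to homology classes *)

Lemma homology_pi_eqP (R : realType) (X : top_pair) n (y z : cycles R X n) :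
  \pi_(homology R X n) y = \pi_(homology R X n) z <->
  exists d : chain R X n.+1, cycle_chain y - cycle_chain z - boundary d \in subchain (pair_sub X).
Proof.
have -> : (\pi_(homology R X n) y = \pi_(homology R X n) z) <-> y - z \in @rel_boundary R X n.
  by rewrite Quotient.idealrBE; split=> /eqP.
by split=> [/asboolP[d dE]|[d dE]]; [|apply/asboolP]; exists d.
Qed.

Lemma contractible1 (R : realType) (X : topologicalType) (p : X) : contractible R [set p].
Proof.
exists p => //; exists (fun=> p); split=> [||x ->//|//].
  by apply: continuous_subspaceT => y; exact: cst_continuous.
by move=> _ [_ _ <-].
Qed.

Lemma addrKl (V : zmodType) (x y : V) : x + y - x = y.
Proof. by rewrite addrAC subrr add0r. Qed.

Lemma addr_regroup (V : zmodType) (a b c y : V) : y = a + b + (y - (a + c) - b + c).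
Proof.
have -> : y - (a + c) - b + c = y - a - b by rewrite opprD addrA [LHS]addrAC subrK.
by rewrite addrACA subrr addr0 addrC subrK.
Qed.

Lemma subchain0 (R : realType) (X : topologicalType) n (c : chain R X n) :
  c \in subchain (@set0 X) -> c = 0.
Proof.
move=> /asboolP c0; rewrite (chain_sumE c) big_seq big1// => s /c0 s0.
by case: (s0 (s (vertex R n))); exists (vertex R n).
Qed.

Lemma orbit_fun_proj (gT : finGroupType) (G : {group gT}) (X Y : gspace G) (f : gmap X Y) x :
  orbit_fun f (quot_proj (@orbit_rel _ _ X) x) = quot_proj (@orbit_rel _ _ Y) (f x).
Proof. by rewrite /orbit_fun quot_lift_proj//; exact: orbit_fun_subproof. Qed.

Lemma chain_map_orbit_id (R : realType) (gT : finGroupType) (G : {group gT}) (X : gspace G) n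
    (c : chain R (orbit_space X) n) : chain_map (orbit_fun (gidfun X)) c = c.
Proof.
by apply: chain_map_id => p; have [u ->] := quot_proj_surj p; exact: orbit_fun_proj.
Qed.

Lemma absolute_cycle (R : realType) (gT : finGroupType) (G : {group gT}) (X : gspace G) n
    (y : cycles R (orbit_pair (@set0 X)) n) : boundary (cycle_chain y) = 0.
Proof. by apply: subchain0; move: (valP y); rewrite unfold_in /= image_set0. Qed.

Lemma chain_map_orbit_sub (R : realType) (gT : finGroupType) (G : {group gT}) (X Z : gspace G)
    (f : gmap X Z) (B : set X) (e : Z) n (c : chain R (orbit_space X) n) :
  (forall b, B b -> exists2 g, g \in G & f b = gact g e) ->
  c \in subchain (pair_sub (orbit_pair B)) ->
  chain_map (orbit_fun f) c \in subchain [set orbit_cts Z e].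
Proof.
move=> fB; apply: (@additive_subchain _ _ _ _ _ n (@chain_map R _ _ (orbit_fun f) n)) => s sB.
rewrite [X in X \in _](chain_map_gen (orbit_fun f) s).
apply: subchain_gen => _ [p _ <-] /=.
have [|b Bb <-] := sB (s p); first by exists p.
by rewrite orbit_fun_proj; have [g Gg ->] := fB b Bb; exact: orbit_proj_gact.
Qed.

Section TakasuComparison.
Variables (R : realType) (gT : finGroupType) (H : {group gT}).
Local Notation G := [set: gT]%G.
Variable t : gT.
Hypothesis G_cycle : G = <[t]>%g :> {set gT}.
Hypothesis t_order : #[t]%g = 4%N.
Hypothesis H_cycle : H = <[t ^+ 2]>%g :> {set gT}.
Variables (EH : gspace H) (EG : gspace G) (i : gmap (induced EH) EG).
Hypothesis EH_hausdorff : hausdorff_space EH.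
Hypothesis EH_free : forall g (x : EH), g \in H -> gact g x = x -> g = 1%g.
Hypothesis EG_hausdorff : hausdorff_space EG.
Hypothesis EG_free : forall g (y : EG), g \in G -> gact g y = y -> g = 1%g.
Hypothesis EG_contractible : contractible R [set: EG].
Hypothesis i_inj : injective i.
Hypothesis i_closed : forall C, closed C -> closed (i @` C).

Lemma takasu_homology_nonzero m : odd m -> exists x : takasu_homology R i m.+2, x <> 0.
Proof.
move=> om; have [z z0 zN] := relative_chain_nonzero G_cycle t_order H_cycle EH_hausdorff EH_free
  EG_hausdorff EG_free EG_contractible i_inj i_closed om.
have zC : z \in @rel_cycle R (orbit_pair (range i)) m.+2 by rewrite unfold_in z0 rpred0.
exists (\pi_(homology R (orbit_pair (range i)) m.+2) (Cycle zC)).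
move=> pi0.
have /homology_pi_eqP[d] : \pi_(homology R (orbit_pair (range i)) m.+2) (Cycle zC) =
  \pi_(homology R (orbit_pair (range i)) m.+2) 0 by rewrite pi0 raddf0.
rewrite [cycle_chain 0](_ : _ = 0)// subr0 => dB.
by have := zN d; rewrite dB.
Qed.

Hypothesis EH_contractible : contractible R [set: EH].
Variables (T Z : gspace G) (q : gmap EG T) (f : gmap T Z) (B : set T) (e : Z).
Hypothesis qB : q @` range i `<=` B.
Hypothesis fB : forall b, B b -> exists2 g, g \in G & f b = gact g e.
Hypothesis f_induced : forall x, f (q (induced_map i x)) = e.
Hypothesis Z_contractible : contractible R [set: Z].
Hypothesis Z_fixed_contractible : contractible R (@fixed_points _ _ Z H).
Hypothesis idB : gidfun T @` set0 `<=` B.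
Hypothesis f0 : f @` set0 `<=` @set0 Z.

Definition gcomp : gmap EG Z :=
  @GMap _ _ EG Z (f \o q : continuousType _ _)
    (fun g Gg y => etrans (congr1 f (gfunJ q Gg y)) (gfunJ f Gg (q y))).

Let gG : continuousType (orbit_space EG) (orbit_space Z) := orbit_fun f \o orbit_fun q.

Let gG_orbit y : gG (orbit_cts EG y) = orbit_cts Z (gcomp y).
Proof. by rewrite /= !orbit_fun_proj. Qed.

(** In the orbit space of [Z], the image of [y] is a boundary plus a chain at one point. That chain
    is a cycle, because [y] is an absolute one, and in positive degree a cycle at a point bounds. *)
Lemma homology_map_vanish m (z : cycles R (orbit_pair (range i)) m.+2)
    (y : cycles R (orbit_pair (@set0 T)) m.+2) :
  homology_map (orbit_map idB) (\pi_(homology R _ m.+2) y) =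
    homology_map (orbit_map qB) (\pi_(homology R _ m.+2) z) ->
  homology_map (orbit_map f0) (\pi_(homology R _ m.+2) y) = 0.
Proof.
rewrite !homology_map_pi => /homology_pi_eqP[d dE].
have yE : cycle_chain (cycle_map (orbit_map idB) y) = cycle_chain y.
  exact: chain_map_orbit_id.
have y0 := absolute_cycle y.
have z0 : boundary (cycle_chain z) \in subchain (quot_proj (@orbit_rel _ _ EG) @` range i).
  exact: (valP z).
have [w [c [cP zE]]] := relative_chain_vanish G_cycle t_order H_cycle EH_hausdorff EH_free
  EH_contractible EG_hausdorff EG_free EG_contractible i_inj i_closed Z_contractible
  Z_fixed_contractible gG_orbit f_induced z0.
move: dE; rewrite yE; set c1 := (X in X \in _) => c1P.
have Fc1 := chain_map_orbit_sub fB c1P.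
pose F := chain_map (R := R) (orbit_fun f).
have FB n (u v : chain R (orbit_space T) n) : F n (u - v) = F n u - F n v by exact: raddfB.
have FyE : F _ (cycle_chain y) = boundary (w + F _ d) + (F _ c1 + c).
  have FzE : F _ (cycle_chain (cycle_map (orbit_map qB) z)) = boundary w + c.
    by rewrite -zE; exact: chain_map_comp.
  have FdE : F _ (boundary d) = boundary (F _ d) by rewrite [RHS]boundary_chain_map.
  have Fc1E : F _ c1 = F _ (cycle_chain y) - (boundary w + c) - boundary (F _ d).
    by rewrite /c1 !FB -FzE -FdE.
  rewrite Fc1E (raddfD (@boundary R _ m.+3)); exact: addr_regroup.
have c0 : boundary (F _ c1 + c) = 0.
  have -> : F _ c1 + c = F _ (cycle_chain y) - boundary (w + F _ d).
    by rewrite FyE; exact: (esym (addrKl (boundary (w + F _ d)) (F _ c1 + c))).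
  have bB u v : boundary (u - v : chain R (orbit_space Z) m.+2) = boundary u - boundary v.
    exact: raddfB.
  have bb : boundary (boundary (w + F _ d) : chain R (orbit_space Z) m.+2) = 0.
    exact: (@boundaryK R _ m.+3 (w + F _ d)).
  by rewrite bB bb subr0 boundary_chain_map y0 raddf0.
have c1c : F _ c1 + c \in subchain [set orbit_cts Z e] by exact: rpredD.
have [v _ vE] := @contractible_exact R _ _ (contractible1 R (orbit_cts Z e)) m.+2 _ c1c c0.
apply: (etrans (y := \pi_(homology R (orbit_pair (@set0 Z)) m.+2) 0)); last by rewrite raddf0.
apply/homology_pi_eqP; exists (w + F _ d + v).
rewrite [X in X \in _](_ : _ = 0) ?rpred0//.
rewrite [cycle_chain 0](_ : _ = 0)// subr0 [cycle_chain (cycle_map _ _)]FyE vE.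
by rewrite [in X in _ - X](raddfD (@boundary R _ m.+3)) subrr.
Qed.

End TakasuComparison.

(** * The base of the Takasu space *)

Section Takasu.
Variables (gT : finGroupType) (H : {group gT}) (X : gspace H).
Local Notation G := [set: gT]%G.
Variables (Y Z : gspace G) (i : gmap (induced X) Y) (f : gmap (takasu_space i) Z).
Local Notation inl_map := (pushout_inl (collapse X) i).
Local Notation inr_map := (pushout_inr (collapse X) i).

Definition coset_point : coset_gspace H := quot_proj (@coset_rel gT H) (1%g : translation_space gT).

(** [G] permutes the cosets transitively, so the base maps into a single orbit. *)
Lemma takasu_base_orbit b : takasu_base (i := i) b ->
  exists2 g, g \in G & f b = gact g (f (inl_map coset_point)).
Proof.
move=> [a _ <-]; have [g ->] := quot_proj_surj a.
have -> : quot_proj (@coset_rel gT H) g = gact (g : gT) coset_point.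
  by rewrite -(quot_gprojJ (@coset_relJ gT H)) ?inE// /= /translation mulg1.
by exists g; rewrite ?inE// !gfunJ ?inE.
Qed.

Lemma collapse_induced_unit x : collapse X (induced_unit x) = coset_point.
Proof.
apply: quot_lift_proj => p q [h Hh [g [u [-> ->]]]] /=.
by apply/esym/quot_proj_eq; exists h.
Qed.

(** The pushout glues the point [[1, x]] of the induced space to the coset of 1. *)
Lemma takasu_collapse x : f (inr_map (induced_map i x)) = f (inl_map coset_point).
Proof.
apply: (congr1 f); apply/esym; apply: quot_proj_eq; exists (induced_unit x).
by rewrite collapse_induced_unit.
Qed.

End Takasu.

Lemma isotropy1_free (gT : finGroupType) (G : {group gT}) (X : gspace G) :
  (forall x : X, isotropy x = 1%g) -> forall g (x : X), g \in G -> gact g x = x -> g = 1%g.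
Proof.
move=> X1 g x Gg gx; apply/set1P; rewrite -[[set 1%g]%SET]/(1%g : {set gT}) -(X1 x).
by rewrite inE Gg; exact/asboolP.
Qed.

Theorem mainTheorem7 (R : realType) (gT : finGroupType) (H : {group gT})
  (G_cyclic : cyclic [set: gT]%G) (G_order : #|[set: gT]%G| = 4%N)
  (H_order : #|H| = 2%N)
  (EH : gspace H) (cwEH : gcw R EH) (EH_univ : free_contractible R EH)
  (EG : gspace [set: gT]%G) (cwEG : gcw R EG)
  (EG_univ : free_contractible R EG)
  (i : gmap (induced EH) EG) (i_incl : subcomplex_inclusion cwEG i)
  (EFG : gspace [set: gT]%G) (cwEFG : gcw R EFG)
  (EFG_class : classifying_space R (subconjugates [set: gT]%G H) EFG)
  (f : gmap (takasu_space i) EFG) :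
  (forall n : nat, (2 <= n)%N ->
     forall x : takasu_homology R i n, comparison f x = 0) /\
  (forall n : nat, (2 <= n)%N -> odd n ->
     ~ bijective (fun x : takasu_homology R i n => comparison f x)).
Proof.
have /cyclicP[t G_cycle] := G_cyclic.
have t_order : #[t]%g = 4%N by rewrite orderE -G_cycle.
have H_cycle : H = <[t ^+ 2]>%g :> {set gT}.
  (* A cyclic group has at most one subgroup of each order. *)
  apply/eqP; rewrite (eq_subG_cyclic G_cyclic) ?finset.subsetT//.
  by rewrite -orderE orderXdiv t_order// H_order.
have [EH1 EHc] := EH_univ; have [EG1 EGc] := EG_univ.
have EH_free := isotropy1_free EH1; have EG_free := isotropy1_free EG1.
have EHh := gcw_hausdorff cwEH; have EGh := gcw_hausdorff cwEG.
have [i_inj i_closed _] := i_incl; have [_ EFGc] := EFG_class.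
have EFG_fixed : contractible R (@fixed_points _ _ EFG H).
  by apply: EFGc; split; [exact: finset.subsetT|exists 1%g; rewrite ?inE// conjsg1].
have EFG_contractible : contractible R [set: EFG].
  (* The trivial subgroup belongs to the family, and it fixes every point. *)
  rewrite (_ : setT = @fixed_points _ _ EFG 1%g); last first.
    by apply/seteqP; split=> // x _ k /set1P ->; exact: gact1.
  by apply: (EFGc 1%G); split; [exact: finset.subsetT|exists 1%g; rewrite ?inE// conjsg1 sub1G].
have zero m (x : takasu_homology R i m.+2) : comparison f x = 0.
  (* [xget] returns either a class with the same relative image as [x] or its default 0; the default
     is mapped to 0 by additivity. *)
  rewrite /comparison; case: xgetP => [y _|_]; last by rewrite /bredon_map raddf0.
  rewrite /= -[y]reprK -[x]reprK.
  apply: (homology_map_vanish G_cycle t_order H_cycle EHh EH_free EGh EG_free EGc i_inj i_closed EHc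
    (takasu_base_orbit f) (takasu_collapse f) EFG_contractible EFG_fixed).
split=> [[|[|n]]//|[|[|n]]// _ /=]; rewrite negbK => odd_n bij.
have [x xN] := takasu_homology_nonzero G_cycle t_order H_cycle EHh EH_free EGh EG_free EGc
  i_inj i_closed odd_n.
(* Injectivity fails because the nonzero class [x] and 0 have the same image. *)
by apply: xN; apply: (bij_inj bij); rewrite !zero.
Qed.
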